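(* Let $\varepsilon>0$ be small and let $(u_0,v_0)\in X_1\times Y_1$ with $f(u_0,v_0)=0$. Then there exists a unique strict solution $(u^\varepsilon,v^\varepsilon)$ of the system $$\partial_t u^\varepsilon(t)=Au^\varepsilon(t)+\frac1\varepsilon f(u^\varepsilon(t),v^\varepsilon(t)),\qquad \partial_t v^\varepsilon(t)=Bv^\varepsilon(t)+g(u^\varepsilon(t),v^\varepsilon(t)),\qquad u^\varepsilon(0)=u_0,\ v^\varepsilon(0)=v_0,$$ that is, a unique solution satisfying $(u^\varepsilon,v^\varepsilon)\in C^1([0,\infty);X\times Y)\cap C([0,\infty);X_1\times Y_1)$.
   Context: Operators. $X,Y$ are Banach spaces. $A:X\supset D(A)\to X$ and $B:Y\supset D(B)\to Y$ are closed, densely defined linear operators generating $C_0$-semigroups $(\mathrm e^{tA})_{t\ge0}\subset\mathcal B(X)$ and $(\mathrm e^{tB})_{t\ge0}\subset\mathcal B(Y)$, where $\mathcal B(E,F)$ denotes the bounded linear operators $E\to F$ and $\mathcal B(E)=\mathcal B(E,E)$. $X_1=D(A)$, $Y_1=D(B)$. $(X_\beta)_{\beta\in[-1,\infty)}$ and $(Y_\beta)_{\beta\in[-1,\infty)}$ are the interpolation-extrapolation scales generated by $(X,A)$ and $(Y,B)$: (with $0$ in the resolvent set of the operator) $X_k=D(A^k)$ with norm $\|A^kx\|_X$ for $k\in\mathbb N_0$, $X_{-1}$ is the completion of $X$ under $\|A^{-1}x\|_X$, and $X_{k+\theta}=(X_k,X_{k+1})_\theta$ for $\theta\in(0,1)$,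 where $(\cdot,\cdot)_\theta$ is an exact admissible interpolation functor (exact, and $X_1$ is dense in $(X_0,X_1)_\theta$ whenever $X_1$ is densely embedded in $X_0$); similarly for $Y$. Let $\gamma\in(0,1]$ if $(\mathrm e^{tA})$ is analytic and $\gamma=1$ otherwise; let $\delta\in(0,1]$ if $(\mathrm e^{tB})$ is analytic and $\delta=1$ otherwise. There are constants $C_A,C_B,M_A,M_B>0$ and $\omega_A,\omega_B\in\mathbb R$ such that for all $t>0$ $$\|\mathrm e^{tA}\|_{\mathcal B(X_1)}\le M_A\mathrm e^{\omega_At},\ \ \|\mathrm e^{tA}\|_{\mathcal B(X_\gamma,X_1)}\le C_At^{\gamma-1}\mathrm e^{\omega_At},\ \ \|\mathrm e^{tB}\|_{\mathcal B(Y_1)}\le M_B\mathrm e^{\omega_Bt},\ \ \|\mathrm e^{tB}\|_{\mathcal B(Y_\delta,Y_1)}\le C_Bt^{\delta-1}\mathrm e^{\omega_Bt}.$$ Nonlinearities. Let $\alpha\in[0,1)$ with $0\le\gamma-(1-\alpha)\le1$. $f:X_\alpha\times Y_1\to X_{\gamma-(1-\alpha)}$ is twice continuously Fréchet differentiable, $f(x,y)\in X_\gamma$ if $(x,y)\in X_1\times Y_1$, and $g:X_1\times Y_1\to Y_\delta$ is Fréchet differentiable. There are $L_f,L_g>0$ with $\|\mathrm Df(x,y)\|_{\mathcal B(X_1\times Y_1,X_\gamma)}\le L_f$, $\|\mathrm Dg(x,y)\|_{\mathcal B(X_1\times Y_1,Y_\delta)}\le L_g$ for $(x,y)\in X_1\times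 Y_1$ and $\|\mathrm Df(\tilde x,\tilde y)\|_{\mathcal B(X_\alpha\times Y_\alpha,X_{\gamma-(1-\alpha)})}\le L_f$ for $(\tilde x,\tilde y)\in X_\alpha\times Y_\alpha$; consequently $f$ and $g$ are globally Lipschitz between the corresponding spaces with constants $L_f$, $L_g$. Moreover $f(0,0)=0$ and $g(0,0)=0$. Standing assumption of the paper on the initial data: $(u_0,v_0)\in X_1\times Y_1$ and $f(u_0,v_0)=0$. *)

(* Defs.v *)
From Stdlib Require Import Reals ClassicalEpsilon.
From Coquelicot Require Export Coquelicot.
Set Implicit Arguments.
Unset Strict Implicit.
Unset Printing Implicit Defensive.
Open Scope R_scope.

(* Banach spaces are real; a complex Banach space is in particular a real one.
   Boundedness of a linear map is part of Coquelicot's [is_linear]. *)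
Notation Banach := (CompleteNormedModule R_AbsRing).
Notation Normed := (NormedModule R_AbsRing).

(* The value [op A x] is meaningful only for [x] in [dom A]. *)
Record operator (X : Normed) := Operator {
  dom : X -> Prop;
  op : X -> X;
  dom_zero : dom zero;
  dom_plus : forall x y, dom x -> dom y -> dom (plus x y);
  dom_scal : forall (k : R) x, dom x -> dom (scal k x);
  op_plus : forall x y, dom x -> dom y -> op (plus x y) = plus (op x) (op y);
  op_scal : forall (k : R) x, dom x -> op (scal k x) = scal k (op x)
}.

Definition closed_operator (X : Normed) (A : operator X) : Prop :=
  closed (T := prod_UniformSpace X X)
    (fun p => dom A (fst p) /\ snd p = op A (fst p)).

Definition densely_defined (X : Normed) (A : operator X) : Prop :=
  forall (x : X) (eps : posreal), exists y, dom A y /\ ball x eps y.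

Definition zero_in_resolvent_set (X : Normed) (A : operator X) : Prop :=
  exists S : X -> X, is_linear S /\
    (forall x, dom A (S x) /\ op A (S x) = x) /\
    (forall x, dom A x -> S (op A x) = x).

(* Only the values [T t] with [0 <= t] are relevant. *)
Record C0_semigroup (X : Normed) (T : R -> X -> X) : Prop := {
  semigroup_linear : forall t, 0 <= t -> is_linear (T t);
  semigroup_0 : forall x, T 0 x = x;
  semigroup_plus : forall s t x, 0 <= s -> 0 <= t -> T (s + t) x = T s (T t x);
  semigroup_continuous :
    forall x, filterlim (fun t => T t x) (at_right 0) (locally x)
}.

Definition generates (X : Normed) (A : operator X) (T : R -> X -> X) : Prop :=
  forall x y : X, (dom A x /\ op A x = y) <->
    filterlim (fun t => scal (/ t) (minus (T t x) x)) (at_right 0) (locally y).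

(* Multiplication by a complex number on the complexification X + iX, whose
   elements x + iy are represented by pairs. *)
Definition cscal (X : Normed) (z : C) (p : prod_NormedModule R_AbsRing X X) :
    prod_NormedModule R_AbsRing X X :=
  (minus (scal (fst z) (fst p)) (scal (snd z) (snd p)),
   plus (scal (fst z) (snd p)) (scal (snd z) (fst p))).

(* The sector |arg z| < arctan k. *)
Definition sector (k : R) (z : C) : Prop :=
  0 < fst z /\ Rabs (snd z) < k * fst z.

(* The complexification of T extends to a semigroup of bounded complex-linear
   operators on a sector, which is holomorphic in operator norm and strongly
   continuous at 0. *)
Definition analytic_semigroup (X : Normed) (T : R -> X -> X) : Prop :=
  let XC := prod_NormedModule R_AbsRing X X in
  exists (k : R) (S : C -> XC -> XC), 0 < k /\
    (forall z, sector k z ->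
       is_linear (S z) /\ forall x, S z (cscal Ci x) = cscal Ci (S z x)) /\
    (forall t (x : XC), 0 < t -> S (RtoC t) x = (T t (fst x), T t (snd x))) /\
    (forall z w x, sector k z -> sector k w -> S (Cplus z w) x = S z (S w x)) /\
    (forall x, filterlim (fun z => S z x)
       (within (sector k) (locally (RtoC 0))) (locally x)) /\
    (forall z, sector k z -> exists S' : XC -> XC, is_linear S' /\
       forall eta, 0 < eta -> exists r, 0 < r /\
         forall (h : C) (x : XC), Cmod h < r ->
           norm (minus (minus (S (Cplus z h) x) (S z x)) (cscal h (S' x)))
             <= eta * Cmod h * norm x).

Record banach_in (V : Normed) := BanachIn {
  space :> Banach;
  emb : space -> V;
  emb_linear : is_linear emb;
  emb_inj : forall x y, emb x = emb y -> x = y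
}.
Arguments emb {V b} _.

(* The element of [F] equal to [x] as an element of [V]; meaningful only if
   there is one. *)
Definition incl (V : Normed) (E F : banach_in V) (x : E) : F :=
  epsilon (inhabits zero) (fun y : F => emb y = emb x).
Arguments incl {V E F} x.

Definition opnorm_le (U V : Normed) (T : U -> V) (M : R) : Prop :=
  forall x, norm (T x) <= M * norm x.

(* [T] maps [E] into [F], with norm at most [M] in B(E, F). *)
Definition maps (V W : Normed) (E : banach_in V) (F : banach_in W)
    (T : V -> W) (M : R) : Prop :=
  forall x : E, exists y : F, emb y = T (emb x) /\ norm y <= M * norm x.

Definition whole_space (X : Banach) : banach_in X :=
  @BanachIn X X (fun x => x) (is_linear_id (V := X)) (fun x y e => e).

(* [X1] is D(A) with the norm |A x|. *)
Definition domain_space (X : Normed) (A : operator X) (X1 : banach_in X) : Prop :=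
  (forall x, dom A x <-> exists y : X1, emb y = x) /\
  (forall y : X1, norm y = norm (op A (emb y))).

Definition in_sum (V : Normed) (E0 E1 : banach_in V) (v : V) : Prop :=
  exists (e0 : E0) (e1 : E1), v = plus (emb e0) (emb e1).

Definition linear_on (V W : Normed) (P : V -> Prop) (T : V -> W) : Prop :=
  (forall x y, P x -> P y -> T (plus x y) = plus (T x) (T y)) /\
  (forall (k : R) x, P x -> T (scal k x) = scal k (T x)).

Definition densely_embedded (V : Normed) (E F : banach_in V) : Prop :=
  (exists M, maps E F (fun x => x) M) /\
  (forall (y : F) eta, 0 < eta ->
     exists (x : E) (z : F), emb z = emb x /\ norm (minus y z) < eta).

(* A construction (E0, E1) |-> (E0, E1)_theta on Banach couples, the couple
   being embedded in a common space [V]. *)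
Definition interpolation_method :=
  forall V : Normed, banach_in V -> banach_in V -> banach_in V.

(* [interp_exact] is the exactness inequality of interpolation theory; it is
   implied by exactness of exponent theta, M = M0^(1-theta) M1^theta. *)
Record exact_admissible (I : interpolation_method) : Prop := {
  interp_cap : forall (V : Normed) (E0 E1 : banach_in V), exists K,
    forall (e0 : E0) (e1 : E1), emb e0 = emb e1 ->
      exists x : I V E0 E1, emb x = emb e0 /\ norm x <= K * Rmax (norm e0) (norm e1);
  interp_sum : forall (V : Normed) (E0 E1 : banach_in V), exists K,
    forall x : I V E0 E1, exists (e0 : E0) (e1 : E1),
      emb x = plus (emb e0) (emb e1) /\ norm e0 + norm e1 <= K * norm x;
  interp_exact : forall (V W : Normed) (E0 E1 : banach_in V) (F0 F1 : banach_in W)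
      (T : V -> W) (M0 M1 : R),
    0 <= M0 -> 0 <= M1 -> linear_on (in_sum E0 E1) T ->
    maps E0 F0 T M0 -> maps E1 F1 T M1 ->
    maps (I V E0 E1) (I W F0 F1) T (Rmax M0 M1);
  interp_dense : forall (V : Normed) (E0 E1 : banach_in V),
    densely_embedded E1 E0 -> densely_embedded E1 (I V E0 E1)
}.

(* The part 0 <= beta <= 1 of the interpolation-extrapolation scale. *)
Definition scale (I : R -> interpolation_method) (X : Banach) (X1 : banach_in X)
    (beta : R) : banach_in X :=
  if Req_EM_T beta 0 then whole_space X
  else if Req_EM_T beta 1 then X1
  else I beta X (whole_space X) X1.

Definition twice_continuously_differentiable (U V : Normed) (f : U -> V) : Prop :=
  exists (Df : U -> U -> V) (D2f : U -> U -> U -> V),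
    (forall p, filterdiff f (locally p) (Df p)) /\
    (forall p,
       (forall h, is_linear (D2f p h)) /\
       (forall k, is_linear (fun h => D2f p h k)) /\
       (exists M, forall h k, norm (D2f p h k) <= M * norm h * norm k) /\
       (forall eta, 0 < eta -> exists r, 0 < r /\ forall h, norm h < r ->
          opnorm_le
            (fun k => minus (minus (Df (plus p h) k) (Df p k)) (D2f p h k))
            (eta * norm h))) /\
    (forall p eta, 0 < eta -> exists r, 0 < r /\ forall q, norm q < r ->
       forall h k, norm (minus (D2f (plus p q) h k) (D2f p h k))
                     <= eta * norm h * norm k).

(* At the end point 0 these are the one-sided notions. *)
Definition continuous_on_halfline (V : Normed) (w : R -> V) : Prop :=
  forall t, 0 <= t ->
    filterlim w (within (Rle 0) (locally t)) (locally (w t)).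

Definition has_derivative_on_halfline (V : Normed) (w w' : R -> V) : Prop :=
  forall t, 0 <= t ->
    filterdiff w (within (Rle 0) (locally t)) (fun h : R => scal h (w' t)).

Definition C1_on_halfline (V : Normed) (w : R -> V) : Prop :=
  exists w', has_derivative_on_halfline w w' /\ continuous_on_halfline w'.

(* [f] is defined on Xa * Y1, where X1 is contained in Xa. *)
Definition strict_solution (X Y : Banach) (A : operator X) (B : operator Y)
    (X1 Xa Z : banach_in X) (Y1 Yd : banach_in Y)
    (f : prod_NormedModule R_AbsRing Xa Y1 -> Z)
    (g : prod_NormedModule R_AbsRing X1 Y1 -> Yd)
    (eps : R) (u0 : X1) (v0 : Y1) (u : R -> X1) (v : R -> Y1) : Prop :=
  continuous_on_halfline u /\ continuous_on_halfline v /\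
  C1_on_halfline (fun t => emb (u t)) /\ C1_on_halfline (fun t => emb (v t)) /\
  has_derivative_on_halfline (fun t => emb (u t))
    (fun t => plus (op A (emb (u t))) (scal (1 / eps) (emb (f (incl (u t), v t))))) /\
  has_derivative_on_halfline (fun t => emb (v t))
    (fun t => plus (op B (emb (v t))) (emb (g (u t, v t)))) /\
  u 0 = u0 /\ v 0 = v0.

(* Main.v *)
Require Import Defs.
From Stdlib Require Import Reals Lra Lia Psatz ClassicalEpsilon.
From Stdlib Require List.
From Coquelicot Require Import Coquelicot.
Open Scope R_scope.

(** The nonlinearities enter through one property: by the mean value inequality and
    the bounds on their derivatives, [f] and [g] are globally Lipschitz from
    [X1 * Y1] into [X_gamma] and [Y_delta] ([lipschitz_of_derivative]).

    For a given continuous right-hand side [h] with values in [X_gamma], the problem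
    [u' = A u + h], [u 0 = u0] is solved by the variation of constants formula
    [u t = e^(tA) u0 + int_0^t e^(sA) h (t - s) ds].  The smoothing estimate
    [|e^(sA) z|_1 <= C s^(gamma - 1) e^(omega s) |z|_gamma] makes the integral converge
    in [X1].  The substitution [s = tau ^ p] with [p gamma >= 2] replaces the weakly
    singular kernel by one that is continuous and vanishes at [0] ([kernel_bound]), so
    that the integral is a Riemann integral in [X1] and [u] is continuous with values
    in [X1].  By the semigroup law ([mild_solution_shift]) the right derivative of [u]
    in [X] is [A u + h], which is continuous; hence [u] is continuously
    differentiable ([derivative_of_right_derivative]).  Conversely, every strict
    solution arises in this way ([linear_cauchy_unique]).

    The strict solutions of the system are therefore the fixed points of
    [(u, v) |-> (S_A (f (u, v) / eps), S_B (g (u, v)))], where [S_A] and [S_B] are the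
    solution operators of the two linear problems.  In the norm
    [sup e^(- lambda t) |h t|] the solution operators have a Lipschitz constant that
    tends to [0] as [lambda] grows ([duhamel_contraction]), so for every [eps] the
    composition is a contraction for large [lambda], and it has exactly one fixed point
    on the whole half-line ([fixed_point_exists_unique]).

    The argument uses bounds on the semigroup in [X] as well as in [X1].  The former
    follow from the latter because [A] is an isometry of [X1] onto [X] that commutes
    with the semigroup ([semigroup_bound]). *)

(** * Linear combinations in modules *)

(** Syntax of linear combinations, for deciding identities between them by comparing
    the coefficients of the atoms. *)
Inductive vexp :=
  | VZero | VAtom (n : nat) | VPlus (a b : vexp) | VOpp (a : vexp)
  | VMinus (a b : vexp) | VScal (k : R) (a : vexp).

Fixpoint veval (V : ModuleSpace R_AbsRing) (env : list V) (e : vexp) : V :=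
  match e with
  | VZero => zero
  | VAtom n => List.nth n env zero
  | VPlus a b => plus (veval V env a) (veval V env b)
  | VOpp a => opp (veval V env a)
  | VMinus a b => minus (veval V env a) (veval V env b)
  | VScal k a => scal k (veval V env a)
  end.

Fixpoint vcoef (e : vexp) (n : nat) : R :=
  match e with
  | VZero => 0
  | VAtom m => if Nat.eqb m n then 1 else 0
  | VPlus a b => vcoef a n + vcoef b n
  | VOpp a => - vcoef a n
  | VMinus a b => vcoef a n - vcoef b n
  | VScal k a => k * vcoef a n
  end.

Fixpoint lincomb (V : ModuleSpace R_AbsRing) (c : nat -> R) (env : list V) : V :=
  match env with
  | nil => zero
  | cons v env => plus (scal (c O) v) (lincomb V (fun n => c (S n)) env)
  end.

Section Lincomb.
Variable V : ModuleSpace R_AbsRing.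
Implicit Types (env : list V) (c d : nat -> R).

Lemma lincomb_zero env c : (forall n, c n = 0) -> lincomb V c env = zero.
Proof.
revert c; induction env as [|v env IH]; intros c Hc; simpl; trivial.
rewrite Hc, IH by auto.
now rewrite plus_zero_r; apply (scal_zero_l v).
Qed.

Lemma lincomb_plus env c d :
  lincomb V (fun n => c n + d n) env = plus (lincomb V c env) (lincomb V d env).
Proof.
revert c d; induction env as [|v env IH]; intros c d; simpl.
- now rewrite plus_zero_r.
- rewrite (IH (fun n => c (S n)) (fun n => d (S n))).
  rewrite (scal_distr_r (c O) (d O) v : scal (c O + d O) v = _).
  rewrite <- !plus_assoc; f_equal.
  rewrite !plus_assoc; f_equal; apply plus_comm.
Qed.

Lemma lincomb_scal env k c :
  lincomb V (fun n => k * c n) env = scal k (lincomb V c env).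
Proof.
revert c; induction env as [|v env IH]; intros c; simpl.
- now rewrite (scal_zero_r k).
- rewrite (IH (fun n => c (S n))).
  rewrite (scal_distr_l k); f_equal.
  now rewrite (scal_assoc k (c O) v).
Qed.

Lemma lincomb_ext env c d :
  (forall n, (n < length env)%nat -> c n = d n) -> lincomb V c env = lincomb V d env.
Proof.
revert c d; induction env as [|v env IH]; intros c d H; simpl; trivial.
rewrite (H O) by (simpl; lia); f_equal; apply IH.
intros n Hn; apply H; simpl; lia.
Qed.

Lemma lincomb_opp env c : lincomb V (fun n => - c n) env = opp (lincomb V c env).
Proof.
transitivity (lincomb V (fun n => - (1) * c n) env).
- apply lincomb_ext; intros n _; ring.
- rewrite lincomb_scal; exact (scal_opp_one (lincomb V c env)).
Qed.

Lemma lincomb_atom env m :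
  lincomb V (fun n => if Nat.eqb m n then 1 else 0) env = List.nth m env zero.
Proof.
revert m; induction env as [|v env IH]; intros m; simpl.
- now destruct m.
- destruct m as [|m]; simpl.
  + rewrite lincomb_zero by auto.
    rewrite plus_zero_r; apply (scal_one v).
  + rewrite (IH m : lincomb V (fun n => if Nat.eqb m n then 1 else 0) env = _).
    now rewrite (scal_zero_l v : scal 0 v = zero), plus_zero_l.
Qed.

Lemma veval_lincomb env e : veval V env e = lincomb V (vcoef e) env.
Proof.
induction e as [|m|a IHa b IHb|a IHa|a IHa b IHb|k a IHa]; simpl.
- now rewrite lincomb_zero.
- now rewrite lincomb_atom.
- now rewrite IHa, IHb, <- lincomb_plus.
- now rewrite IHa, <- lincomb_opp.
- rewrite IHa, IHb; unfold minus; rewrite <- lincomb_opp, <- lincomb_plus.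
  now apply lincomb_ext.
- now rewrite IHa, <- lincomb_scal.
Qed.

Lemma veval_eq env a b :
  List.map (vcoef a) (List.seq 0 (length env)) =
    List.map (vcoef b) (List.seq 0 (length env)) ->
  veval V env a = veval V env b.
Proof.
intros H; rewrite !veval_lincomb; apply lincomb_ext; intros n Hn.
apply (f_equal (fun l => List.nth n l 0)) in H.
rewrite (List.nth_indep (List.map (vcoef a) _) 0 (vcoef a O)),
  (List.nth_indep (List.map (vcoef b) _) 0 (vcoef b O)) in H
  by now rewrite List.length_map, List.length_seq.
now rewrite !List.map_nth, List.seq_nth in H.
Qed.

End Lincomb.

Ltac vindex x env :=
  lazymatch env with
  | cons x _ => constr:(O)
  | cons _ ?env' => let n := vindex x env' in constr:(S n)
  end.

Ltac vmem x env :=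
  lazymatch env with
  | nil => constr:(false)
  | cons x _ => constr:(true)
  | cons _ ?env' => vmem x env'
  end.

Ltac vatoms e env :=
  lazymatch e with
  | plus ?a ?b => let env := vatoms a env in vatoms b env
  | minus ?a ?b => let env := vatoms a env in vatoms b env
  | opp ?a => vatoms a env
  | scal _ ?a => vatoms a env
  | zero => env
  | _ => let b := vmem e env in
         lazymatch b with true => env | false => constr:(cons e env) end
  end.

Ltac vreify e env :=
  lazymatch e with
  | plus ?a ?b => let a := vreify a env in let b := vreify b env in
      constr:(VPlus a b)
  | minus ?a ?b => let a := vreify a env in let b := vreify b env in
      constr:(VMinus a b)
  | opp ?a => let a := vreify a env in constr:(VOpp a)
  | scal ?k ?a => let a := vreify a env in constr:(VScal k a)
  | zero => constr:(VZero)
  | _ => let n := vindex e env in constr:(VAtom n)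
  end.

Ltac vec :=
  (* Delays the match on the goal when [vec] is passed as an argument. *)
  idtac;
  lazymatch goal with
  | |- @eq ?T ?a ?b =>
    let env := vatoms a (@nil T) in
    let env := vatoms b env in
    let ra := vreify a env in
    let rb := vreify b env in
    refine (veval_eq _ env ra rb _);
    cbv [vcoef List.map List.seq length Nat.eqb];
    repeat (refine (f_equal2 cons _ _); [try ring; try (field; lra)|]);
    reflexivity
  end.

(** The operations of a normed space are reachable along several convertible but
    syntactically different paths of structure projections, on which rewriting and
    linear arithmetic fail; this selects one path. *)
Ltac canon :=
  repeat (progress (
    change (CompleteNormedModule.AbelianMonoid ?K ?V) with
      (NormedModule.AbelianMonoid K (CompleteNormedModule.NormedModule K V)) in *;
    change (CompleteNormedModule.AbelianGroup ?K ?V) with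
      (NormedModule.AbelianGroup K (CompleteNormedModule.NormedModule K V)) in *;
    change (CompleteNormedModule.ModuleSpace ?K ?V) with
      (NormedModule.ModuleSpace K (CompleteNormedModule.NormedModule K V)) in *;
    change (ModuleSpace.AbelianGroup R_Ring (NormedModule.ModuleSpace R_AbsRing ?V)) with
      (NormedModule.AbelianGroup R_AbsRing V) in *;
    change (ModuleSpace.AbelianMonoid R_Ring (NormedModule.ModuleSpace R_AbsRing ?V)) with
      (NormedModule.AbelianMonoid R_AbsRing V) in *)).

Tactic Notation "vreplace" constr(a) "with" constr(b) "by" tactic3(t) :=
  let H := fresh in assert (H : a = b) by t; canon; rewrite H; clear H.
Tactic Notation "vreplace" constr(a) "with" constr(b) :=
  vreplace a with b by vec.

(** * Limits, continuity and derivatives in terms of norms *)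

Lemma filterlim_norm_iff {V : Normed} {T : Type} {F : (T -> Prop) -> Prop}
    {FF : Filter F} (w : T -> V) (y : V) :
  filterlim w F (locally y) <->
  forall eta, 0 < eta -> F (fun x => norm (minus (w x) y) < eta).
Proof.
rewrite (filterlim_locally_ball_norm w y); split.
- intros H eta Heta; exact (H (mkposreal eta Heta)).
- intros H eta; exact (H eta (cond_pos eta)).
Qed.

Lemma locally_iff (P : R -> Prop) t :
  locally t P <-> exists r, 0 < r /\ forall s, Rabs (s - t) < r -> P s.
Proof.
split.
- intros [r Hr]; exists r; split; [apply cond_pos|exact Hr].
- intros [r [Hr H]]; exists (mkposreal r Hr); exact H.
Qed.

Lemma within_halfline_iff (P : R -> Prop) t :
  within (Rle 0) (locally t) P <->
  exists r, 0 < r /\ forall s, 0 <= s -> Rabs (s - t) < r -> P s.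
Proof.
unfold within; rewrite locally_iff.
split; intros [r [Hr H]]; exists r; split; auto.
Qed.

Lemma at_right_iff (P : R -> Prop) t :
  at_right t P <-> exists r, 0 < r /\ forall s, t < s < t + r -> P s.
Proof.
unfold at_right, within; rewrite locally_iff.
split; intros [r [Hr H]]; exists r; split; trivial.
- intros s Hs; apply H; [|lra]; rewrite Rabs_pos_eq; lra.
- intros s Hs Hts; apply H; apply Rabs_def2 in Hs; lra.
Qed.

Lemma continuous_iff {V : Normed} (w : R -> V) t :
  continuous w t <->
  forall eta, 0 < eta -> exists r, 0 < r /\
    forall s, Rabs (s - t) < r -> norm (minus (w s) (w t)) < eta.
Proof.
refine (iff_trans (filterlim_norm_iff w (w t)) _).
split; intros H eta Heta; apply locally_iff; auto.
Qed.

Lemma continuous_on_halfline_iff {V : Normed} (w : R -> V) :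
  continuous_on_halfline w <->
  forall t, 0 <= t -> forall eta, 0 < eta -> exists r, 0 < r /\
    forall s, 0 <= s -> Rabs (s - t) < r -> norm (minus (w s) (w t)) < eta.
Proof.
unfold continuous_on_halfline; split; intros H t Ht.
- intros eta Heta; apply within_halfline_iff.
  exact (proj1 (filterlim_norm_iff w (w t)) (H t Ht) eta Heta).
- apply (proj2 (filterlim_norm_iff w (w t))).
  intros eta Heta; apply within_halfline_iff; auto.
Qed.

Lemma continuous_on_halfline_linear {U V : Normed} (l : U -> V) (w : R -> U) :
  is_linear l -> continuous_on_halfline w -> continuous_on_halfline (fun t => l (w t)).
Proof.
intros Hl Hw t Ht; apply (filterlim_comp _ _ _ w l _ (locally (w t))); [now apply Hw|].
exact (linear_cont l _ Hl).
Qed.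

Lemma continuous_on_halfline_plus {V : Normed} (w z : R -> V) :
  continuous_on_halfline w -> continuous_on_halfline z ->
  continuous_on_halfline (fun t => plus (w t) (z t)).
Proof.
intros Hw Hz t Ht.
apply (filterlim_comp_2 (G := locally (w t)) (H := locally (z t)));
  [now apply Hw|now apply Hz|apply (filterlim_plus (V := V))].
Qed.

Lemma has_derivative_on_halfline_iff {V : Normed} (w w' : R -> V) :
  has_derivative_on_halfline w w' <->
  forall t, 0 <= t -> forall eta, 0 < eta -> exists r, 0 < r /\
    forall s, 0 <= s -> Rabs (s - t) < r ->
      norm (minus (minus (w s) (w t)) (scal (s - t) (w' t))) <= eta * Rabs (s - t).
Proof.
split.
- intros H t Ht eta Heta; apply within_halfline_iff.
  destruct (H t Ht) as [_ D].
  refine (D t _ (mkposreal eta Heta)).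
  intros P HP; now apply (filter_le_within (Rle 0)).
- intros H t Ht; split; [exact (is_linear_scal_l (w' t))|].
  intros x Hx eta.
  replace x with t; [apply within_halfline_iff, H; trivial; apply cond_pos|].
  apply (filterlim_locally_unique (F := at_right t) (fun y : R => y) t x).
  + intros P HP; now apply (filter_le_within (Rlt t)).
  + intros P HP; generalize (Hx P HP); unfold filtermap.
    rewrite within_halfline_iff, at_right_iff; intros [r [Hr K]].
    exists r; split; trivial; intros s Hs; apply K; [lra|].
    rewrite Rabs_pos_eq; lra.
Qed.

Lemma norm_scal_R {V : Normed} (k : R) (x : V) : norm (scal k x) = Rabs k * norm x.
Proof.
apply Rle_antisym; [apply (norm_scal k x)|].
destruct (Req_dec k 0) as [->|Hk]; [rewrite Rabs_R0, Rmult_0_l; apply norm_ge_0|].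
assert (Hx : norm x <= Rabs (/ k) * norm (scal k x)).
{ replace x with (scal (/ k) (scal k x)) at 1 by vec; exact (norm_scal (/ k) (scal k x)). }
rewrite Rabs_inv in Hx.
assert (Hk' : 0 < Rabs k) by now apply Rabs_pos_lt.
apply (Rmult_le_compat_l (Rabs k)) in Hx; [|lra].
now rewrite <- Rmult_assoc, Rinv_r, Rmult_1_l in Hx by lra.
Qed.

Lemma norm_minus_sym {V : Normed} (x y : V) : norm (minus x y) = norm (minus y x).
Proof. now rewrite <- norm_opp, opp_minus. Qed.

Lemma norm_minus_triangle {V : Normed} (y x z : V) :
  norm (minus x z) <= norm (minus x y) + norm (minus y z).
Proof.
replace (minus x z) with (plus (minus x y) (minus y z)) by vec.
apply norm_triangle.
Qed.

Lemma norm_minus_le {V : Normed} (x y : V) : norm (minus x y) <= norm x + norm y.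
Proof.
unfold minus; apply (Rle_trans _ _ _ (norm_triangle _ _)); rewrite norm_opp; lra.
Qed.

Lemma norm_le_minus {V : Normed} (x y : V) : norm x <= norm (minus x y) + norm y.
Proof.
replace x with (plus (minus x y) y) at 1 by vec.
apply norm_triangle.
Qed.

Lemma norm_minus_self {V : Normed} (x : V) : norm (minus x x) = 0.
Proof. rewrite minus_eq_zero; apply norm_zero. Qed.

Lemma le_all_eps (x y k : R) :
  0 <= k -> (forall eta, 0 < eta -> x <= y + eta * k) -> x <= y.
Proof.
intros Hk H; apply Rnot_lt_le; intros C.
specialize (H ((x - y) / (2 * (k + 1)))).
assert (0 < (x - y) / (2 * (k + 1))) as P by (apply Rdiv_lt_0_compat; lra).
specialize (H P).
assert ((x - y) / (2 * (k + 1)) * (k + 1) = (x - y) / 2) by (field; lra).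
nra.
Qed.

Lemma exp_le a b : a <= b -> exp a <= exp b.
Proof. intros [H| ->]; [left; now apply exp_increasing|apply Rle_refl]. Qed.

(** A right derivative bound suffices.  The set of those [c] up to which the bound with
    constant [M + eta] holds is closed by left continuity and open to the right by the
    hypothesis, so its supremum is [b]. *)
Lemma mean_value_inequality {V : Normed} (w : R -> V) a b M :
  a <= b -> 0 <= M ->
  (forall t, a < t <= b -> forall eta, 0 < eta -> exists r, 0 < r /\
    forall s, a <= s < t -> t - r < s -> norm (minus (w t) (w s)) <= eta) ->
  (forall t, a <= t < b -> forall eta, 0 < eta -> exists r, 0 < r /\
    forall s, t < s < t + r -> s <= b ->
      norm (minus (w s) (w t)) <= (M + eta) * (s - t)) ->
  norm (minus (w b) (w a)) <= M * (b - a).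
Proof.
intros Hab HM Hleft Hright.
apply (@le_all_eps _ _ (b - a)); [lra|]; intros eta Heta.
replace (M * (b - a) + eta * (b - a)) with ((M + eta) * (b - a)) by ring.
set (K := M + eta) in *.
assert (HK : 0 < K) by (unfold K; lra).
set (E := fun c => a <= c <= b /\
  forall s, a <= s <= c -> norm (minus (w s) (w a)) <= K * (s - a)).
assert (Ea : E a).
{ split; [lra|]; intros s Hs; replace s with a by lra.
  rewrite norm_minus_self; lra. }
destruct (completeness E) as [m [Hub Hlub]].
{ exists b; intros c [Hc _]; lra. }
{ now exists a. }
assert (Ham : a <= m) by now apply Hub.
assert (Hmb : m <= b) by (apply Hlub; intros c [Hc _]; lra).
assert (Hlt : forall s, a <= s < m -> norm (minus (w s) (w a)) <= K * (s - a)).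
{ intros s Hs; apply Rnot_lt_le; intros C.
  assert (m <= s); [|lra].
  apply Hlub; intros c [Hc Ec]; apply Rnot_lt_le; intros Hsc.
  assert (norm (minus (w s) (w a)) <= K * (s - a)) by (apply Ec; lra); lra. }
assert (Hm : norm (minus (w m) (w a)) <= K * (m - a)).
{ destruct (Req_dec m a) as [->|Hne]; [apply Ea; lra|].
  apply (@le_all_eps _ _ 1); [lra|]; intros e He.
  destruct (Hleft m ltac:(lra) e He) as [r [Hr L]].
  set (s := Rmax a (m - r / 2)).
  assert (Hs : a <= s < m /\ m - r < s).
  { unfold s; generalize (Rmax_l a (m - r / 2)) (Rmax_r a (m - r / 2)).
    apply Rmax_case; lra. }
  generalize (norm_minus_triangle (w s) (w m) (w a)) (L s ltac:(lra) ltac:(lra))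
    (Hlt s ltac:(lra)).
  nra. }
destruct (Req_dec m b) as [<-|Hne]; trivial.
exfalso.
destruct (Hright m ltac:(lra) eta Heta) as [r [Hr G]].
set (c := Rmin b (m + r / 2)).
assert (Hc : m < c <= b /\ c < m + r).
{ unfold c; generalize (Rmin_l b (m + r / 2)) (Rmin_r b (m + r / 2)).
  apply Rmin_case; lra. }
assert (c <= m); [apply Hub; split; [lra|]|lra].
intros s Hs; destruct (Rtotal_order s m) as [Hsm|[->|Hsm]]; [apply Hlt; lra|trivial|].
generalize (norm_minus_triangle (w m) (w s) (w a)) (G s ltac:(lra) ltac:(lra)).
fold K; nra.
Qed.

(** The mean value inequality along segments. *)
Lemma lipschitz_of_derivative {U V : Normed} (F : U -> V) L :
  0 <= L ->
  (forall p, exists D, filterdiff F (locally p) D /\ opnorm_le D L) ->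
  forall p q, norm (minus (F q) (F p)) <= L * norm (minus q p).
Proof.
intros HL HF p q.
set (N := norm (minus q p)).
assert (HN : 0 <= N) by apply norm_ge_0.
set (x := fun t : R => plus p (scal t (minus q p))).
assert (Hx : forall s t, minus (x s) (x t) = scal (s - t) (minus q p))
  by (intros s t; unfold x; vec).
assert (HD : forall t eta, 0 < eta -> exists r, 0 < r /\ forall s, Rabs (s - t) < r ->
  norm (minus (F (x s)) (F (x t))) <= (L * N + eta) * Rabs (s - t)).
{ intros t eta Heta.
  destruct (HF (x t)) as [D [[_ Ddom] HDL]].
  assert (He : 0 < eta / (N + 1)) by (apply Rdiv_lt_0_compat; lra).
  specialize (Ddom (x t) (fun P HP => HP) (mkposreal _ He)).
  apply locally_norm_le_locally in Ddom; destruct Ddom as [r Hr].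
  exists (r / (N + 1)); split; [apply Rdiv_lt_0_compat; [apply cond_pos|lra]|].
  intros s Hs.
  assert (Hn : norm (minus (x s) (x t)) = Rabs (s - t) * N)
    by (rewrite Hx; apply norm_scal_R).
  assert (HsN : Rabs (s - t) * (N + 1) < r).
  { apply (Rmult_lt_compat_r (N + 1)) in Hs; [|lra].
    now replace (r / (N + 1) * (N + 1)) with (pos r) in Hs by (field; lra). }
  generalize (Rabs_pos (s - t)); intros Ha.
  assert (Hb : ball_norm (x t) r (x s)) by (unfold ball_norm; rewrite Hn; nra).
  specialize (Hr (x s) Hb); simpl in Hr.
  specialize (HDL (minus (x s) (x t))); rewrite Hn in Hr, HDL.
  generalize (norm_le_minus (minus (F (x s)) (F (x t))) (D (minus (x s) (x t))));
    intros Htri.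
  assert (eta / (N + 1) * (N + 1) = eta) by (field; lra).
  nra. }
replace p with (x 0) by (unfold x; vec).
replace q with (x 1) by (unfold x; vec).
replace (L * N) with (L * N * (1 - 0)) by ring.
apply (@mean_value_inequality V (fun t => F (x t)) 0 1); [lra|nra| |].
- intros t Ht eta Heta; destruct (HD t 1 ltac:(lra)) as [r [Hr H]].
  assert (0 < L * N + 1) by nra.
  exists (Rmin r (eta / (L * N + 1))); split.
  { apply Rmin_pos; trivial; apply Rdiv_lt_0_compat; lra. }
  intros s Hs Hst; rewrite norm_minus_sym.
  generalize (Rmin_l r (eta / (L * N + 1))) (Rmin_r r (eta / (L * N + 1))); intros H1 H2.
  assert (Ha : Rabs (s - t) = t - s) by (rewrite Rabs_minus_sym; apply Rabs_pos_eq; lra).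
  apply (Rle_trans _ _ _ (H s ltac:(lra))); rewrite Ha.
  replace eta with ((L * N + 1) * (eta / (L * N + 1))) by (field; lra).
  apply Rmult_le_compat_l; lra.
- intros t Ht eta Heta; destruct (HD t eta Heta) as [r [Hr H]].
  exists r; split; trivial; intros s Hs _.
  assert (Ha : Rabs (s - t) = s - t) by (apply Rabs_pos_eq; lra).
  generalize (H s); rewrite Ha; intros K; apply K; lra.
Qed.

(** A function whose right derivative is continuous is differentiable: the mean
    value inequality applies to its difference with an affine function. *)
Lemma derivative_of_right_derivative {V : Normed} (w w' : R -> V) :
  continuous_on_halfline w -> continuous_on_halfline w' ->
  (forall t, 0 <= t -> forall eta, 0 < eta -> exists r, 0 < r /\ forall s, t < s < t + r ->
    norm (minus (minus (w s) (w t)) (scal (s - t) (w' t))) <= eta * (s - t)) ->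
  has_derivative_on_halfline w w'.
Proof.
rewrite !continuous_on_halfline_iff; intros Hw Hw' HD.
apply has_derivative_on_halfline_iff; intros t Ht eta Heta.
destruct (Hw' t Ht (eta / 2) ltac:(lra)) as [r [Hr Hc]].
exists r; split; trivial; intros s Hs Hst.
set (psi := fun x => minus (w x) (scal x (w' t))).
assert (Hpsi : forall x y, minus (minus (w y) (w x)) (scal (y - x) (w' t)) =
  minus (psi y) (psi x)) by (intros x y; unfold psi; vec).
assert (Main : forall a b, 0 <= a -> a <= b -> Rabs (a - t) < r -> Rabs (b - t) < r ->
  norm (minus (psi b) (psi a)) <= eta * (b - a)).
{ intros a b Ha Hab Hat Hbt.
  assert (Hin : forall x, a <= x <= b -> Rabs (x - t) < r).
  { intros x Hx; apply Rabs_def2 in Hat; apply Rabs_def2 in Hbt; apply Rabs_def1; lra. }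
  apply mean_value_inequality; [trivial|lra| |].
  - intros x Hx e He.
    destruct (Hw x ltac:(lra) (e / 2) ltac:(lra)) as [r1 [Hr1 H1]].
    set (k := norm (w' t)).
    assert (Hk : 0 <= k) by apply norm_ge_0.
    assert (Hq : 0 < e / (2 * (k + 1))) by (apply Rdiv_lt_0_compat; lra).
    exists (Rmin r1 (e / (2 * (k + 1)))); split; [now apply Rmin_pos|].
    intros y Hy Hxy.
    generalize (Rmin_l r1 (e / (2 * (k + 1)))) (Rmin_r r1 (e / (2 * (k + 1)))).
    intros L1 L2.
    replace (minus (psi x) (psi y)) with
      (minus (minus (w x) (w y)) (scal (x - y) (w' t))) by (unfold psi; vec).
    apply (Rle_trans _ _ _ (norm_minus_le _ _)).
    rewrite norm_scal_R; fold k.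
    rewrite (Rabs_pos_eq (x - y)) by lra.
    rewrite norm_minus_sym.
    specialize (H1 y ltac:(lra)).
    rewrite Rabs_minus_sym, Rabs_pos_eq in H1 by lra.
    specialize (H1 ltac:(lra)).
    assert (e / (2 * (k + 1)) * (k + 1) = e / 2) by (field; lra).
    nra.
  - intros x Hx e He.
    destruct (HD x ltac:(lra) (e + eta / 2) ltac:(lra)) as [r1 [Hr1 H1]].
    exists r1; split; trivial; intros y Hy Hyb.
    replace (minus (psi y) (psi x)) with
      (plus (minus (minus (w y) (w x)) (scal (y - x) (w' x)))
        (scal (y - x) (minus (w' x) (w' t)))) by (unfold psi; vec).
    apply (Rle_trans _ _ _ (norm_triangle _ _)).
    rewrite norm_scal_R.
    rewrite (Rabs_pos_eq (y - x)) by lra.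
    specialize (H1 y Hy); specialize (Hc x ltac:(lra) (Hin x ltac:(lra))).
    nra. }
rewrite Hpsi.
destruct (Rle_dec t s) as [Hle|Hle].
- rewrite (Rabs_pos_eq (s - t)) by lra.
  apply Main; trivial; rewrite Rminus_diag, Rabs_R0; lra.
- rewrite norm_minus_sym, Rabs_minus_sym, (Rabs_pos_eq (t - s)) by lra.
  apply Main; trivial; [lra|]; rewrite Rminus_diag, Rabs_R0; lra.
Qed.

(** * Semigroups whose generator is invertible *)

(** Strong continuity and a locally uniform Lipschitz bound of the operators [K s] give
    joint continuity. *)
Lemma continuous_apply {U V : Normed} (K : R -> U -> V) (z : R -> U) t r b :
  0 < r ->
  (forall s, Rabs (s - t) < r -> forall x y,
     norm (minus (K s x) (K s y)) <= b * norm (minus x y)) ->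
  continuous (fun s => K s (z t)) t -> continuous z t ->
  continuous (fun s => K s (z s)) t.
Proof.
intros Hr Hb HK Hz; apply continuous_iff; intros eta Heta.
destruct (proj1 (continuous_iff _ _) HK (eta / 2) ltac:(lra)) as [r1 [Hr1 H1]].
assert (0 <= Rabs b) by apply Rabs_pos.
assert (He : 0 < eta / (2 * (Rabs b + 1))) by (apply Rdiv_lt_0_compat; lra).
destruct (proj1 (continuous_iff _ _) Hz _ He) as [r2 [Hr2 H2]].
exists (Rmin r (Rmin r1 r2)); split; [now repeat apply Rmin_pos|].
intros s Hs.
apply Rmin_Rgt_l in Hs; destruct Hs as [Hs0 Hs].
apply Rmin_Rgt_l in Hs; destruct Hs as [Hs1 Hs2].
specialize (H1 s Hs1); specialize (H2 s Hs2); specialize (Hb s Hs0 (z s) (z t)).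
generalize (norm_minus_triangle (K s (z t)) (K s (z s)) (K t (z t))).
generalize (Rle_abs b) (norm_ge_0 (minus (z s) (z t))).
assert (eta / (2 * (Rabs b + 1)) * (Rabs b + 1) = eta / 2) by (field; lra).
canon; nra.
Qed.

Lemma continuous_halfline_extension {V : Normed} (w : R -> V) t :
  continuous_on_halfline w -> continuous (fun s => w (Rmax 0 s)) t.
Proof.
rewrite continuous_on_halfline_iff; intros H; apply continuous_iff; intros eta Heta.
destruct (H (Rmax 0 t) (Rmax_l 0 t) eta Heta) as [r [Hr K]].
exists r; split; trivial; intros s Hs; apply K; [apply Rmax_l|].
apply (Rle_lt_trans _ (Rabs (s - t))); trivial.
unfold Rmax; destruct (Rle_dec 0 s), (Rle_dec 0 t); unfold Rabs;
  repeat destruct Rcase_abs; lra.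
Qed.

Section Semigroup.
Context {X : Normed} {A : operator X} {T : R -> X -> X}
  (T_semigroup : C0_semigroup T) (T_gen : generates A T)
  (A_resolvent : zero_in_resolvent_set A)
  {X1 : banach_in X} (X1_dom : domain_space A X1).

Lemma semigroup_minus t (x y : X) :
  0 <= t -> T t (minus x y) = minus (T t x) (T t y).
Proof. intros Ht; exact (linear_minus (T t) x y (semigroup_linear T_semigroup Ht)). Qed.

Lemma generates_iff x y :
  dom A x /\ op A x = y <->
  forall eta, 0 < eta -> exists r, 0 < r /\ forall s, 0 < s < r ->
    norm (minus (minus (T s x) x) (scal s y)) <= eta * s.
Proof.
split.
- intros H eta Heta.
  apply (T_gen x y) in H.
  apply (proj1 (filterlim_norm_iff _ _)) with (eta := eta) in H; trivial.
  apply at_right_iff in H; destruct H as [r [Hr H]].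
  exists r; split; trivial; intros s Hs.
  vreplace (minus (minus (T s x) x) (scal s y)) with
    (scal s (minus (scal (/ s) (minus (T s x) x)) y)).
  canon; rewrite norm_scal_R, Rabs_pos_eq by lra.
  specialize (H s ltac:(lra)); canon; nra.
- intros H; apply (T_gen x y).
  apply (proj2 (filterlim_norm_iff _ _)); intros eta Heta.
  apply at_right_iff; destruct (H (eta / 2) ltac:(lra)) as [r [Hr K]].
  exists r; split; trivial; intros s Hs.
  vreplace (minus (scal (/ s) (minus (T s x) x)) y) with
    (scal (/ s) (minus (minus (T s x) x) (scal s y))).
  specialize (K s ltac:(lra)).
  assert (Hs' : 0 < / s) by (apply Rinv_0_lt_compat; lra).
  canon; rewrite norm_scal_R, Rabs_pos_eq by lra.
  assert (/ s * (eta / 2 * s) = eta / 2) by (field; lra).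
  canon; nra.
Qed.

(** [T t] is continuous, hence commutes with the limit that defines [A x]. *)
Lemma semigroup_domain t x :
  0 <= t -> dom A x -> dom A (T t x) /\ op A (T t x) = T t (op A x).
Proof.
intros Ht Hx; apply generates_iff; intros eta Heta.
destruct (linear_norm _ (semigroup_linear T_semigroup Ht)) as [M [HM HT]].
destruct (proj1 (generates_iff x (op A x)) (conj Hx eq_refl) (eta / M)) as [r [Hr K]].
{ now apply Rdiv_lt_0_compat. }
exists r; split; trivial; intros s Hs.
rewrite <- (linear_scal _ (semigroup_linear T_semigroup Ht)).
rewrite <- (semigroup_plus T_semigroup), Rplus_comm, (semigroup_plus T_semigroup) by lra.
rewrite <- !semigroup_minus by trivial.
apply (Rle_trans _ _ _ (HT _)).
replace (eta * s) with (M * (eta / M * s)) by (field; lra).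
apply Rmult_le_compat_l; [lra|]; now apply K.
Qed.

(** Inverse of the embedding of [X1]; meaningful only on the domain of [A]. *)
Definition lift (x : X) : X1 := epsilon (inhabits zero) (fun d : X1 => emb d = x).

Lemma emb_lift x : dom A x -> emb (lift x) = x.
Proof.
intros Hx; apply (epsilon_spec (inhabits zero) (fun d : X1 => emb d = x)).
now apply (proj1 X1_dom).
Qed.

Lemma dom_emb (d : X1) : dom A (emb d).
Proof. apply (proj1 X1_dom); now exists d. Qed.

Lemma lift_emb (d : X1) : lift (emb d) = d.
Proof. apply emb_inj, emb_lift, dom_emb. Qed.

Lemma emb_minus (E : banach_in X) (d e : E) :
  emb (minus d e) = minus (emb d) (emb e).
Proof. exact (linear_minus emb d e (emb_linear E)). Qed.

Lemma op_minus (d e : X1) :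
  op A (emb (minus d e)) = minus (op A (emb d)) (op A (emb e)).
Proof.
rewrite emb_minus.
vreplace (minus (emb d) (emb e)) with (plus (emb d) (scal (- (1)) (emb e))).
rewrite op_plus, op_scal; try apply dom_scal; try apply dom_emb; vec.
Qed.

Lemma norm_minus_domain (d e : X1) :
  norm (minus d e) = norm (minus (op A (emb d)) (op A (emb e))).
Proof. now rewrite (proj2 X1_dom), op_minus. Qed.

Lemma op_continuous (w : R -> X1) :
  continuous_on_halfline w -> continuous_on_halfline (fun t => op A (emb (w t))).
Proof.
rewrite !continuous_on_halfline_iff; intros H t Ht eta Heta.
destruct (H t Ht eta Heta) as [r [Hr K]].
exists r; split; trivial; intros s Hs Hst.
rewrite <- norm_minus_domain; auto.
Qed.

(** The semigroup on [X1]. *)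
Definition T1 (t : R) (d : X1) : X1 := lift (T t (emb d)).

Lemma emb_T1 t d : 0 <= t -> emb (T1 t d) = T t (emb d).
Proof. intros Ht; apply emb_lift, semigroup_domain; trivial; apply dom_emb. Qed.

Lemma op_T1 t d : 0 <= t -> op A (emb (T1 t d)) = T t (op A (emb d)).
Proof.
intros Ht; rewrite emb_T1 by trivial; apply semigroup_domain; trivial; apply dom_emb.
Qed.

Context {M omega : R} (M_pos : 0 < M)
  (T_X1 : forall t, 0 < t -> maps X1 X1 (T t) (M * exp (omega * t))).

(** [A] is an isometry of [X1] onto [X] that commutes with the semigroup, so the
    growth bound in [X1] holds in [X] as well. *)
Lemma semigroup_bound t x :
  0 <= t -> norm (T t x) <= (M + 1) * exp (Rabs omega * t) * norm x.
Proof.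
intros Ht.
assert (Hexp : exp (omega * t) <= exp (Rabs omega * t)).
{ apply exp_le; apply Rmult_le_compat_r; trivial; apply Rle_abs. }
assert (Hexp0 := exp_pos (omega * t)).
assert (Hx := norm_ge_0 x).
destruct (Req_dec t 0) as [->|Hne].
- rewrite (semigroup_0 T_semigroup), Rmult_0_r, exp_0; canon; nra.
- destruct A_resolvent as [S [_ [HS _]]].
  destruct (HS x) as [Hdom Hop].
  destruct (proj1 (proj1 X1_dom (S x)) Hdom) as [d Hd].
  destruct (T_X1 t ltac:(lra) d) as [e [He Hn]].
  rewrite !(proj2 X1_dom), He, Hd in Hn.
  destruct (@semigroup_domain t (S x) Ht Hdom) as [_ E].
  rewrite E, Hop in Hn.
  apply (Rle_trans _ _ _ Hn).
  apply Rmult_le_compat_r; trivial; canon; nra.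
Qed.

Lemma semigroup_lipschitz b t x y : 0 <= t <= b ->
  norm (minus (T t x) (T t y)) <= (M + 1) * exp (Rabs omega * b) * norm (minus x y).
Proof.
intros Ht; rewrite <- semigroup_minus by lra.
apply (Rle_trans _ _ _ (@semigroup_bound t _ ltac:(lra))).
apply Rmult_le_compat_r; [apply norm_ge_0|].
apply Rmult_le_compat_l; [lra|]; apply exp_le, Rmult_le_compat_l; [apply Rabs_pos|lra].
Qed.

Lemma semigroup_right_continuous x eta : 0 < eta ->
  exists r, 0 < r /\ forall s, 0 <= s < r -> norm (minus (T s x) x) < eta.
Proof.
intros Heta; generalize (@semigroup_continuous _ _ T_semigroup x); intros H.
apply (proj1 (filterlim_norm_iff _ _)) with (eta := eta) in H; trivial.
apply at_right_iff in H; destruct H as [r [Hr H]].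
exists r; split; trivial; intros s Hs.
destruct (Req_dec s 0) as [->|Hne]; [|apply H; lra].
now rewrite (semigroup_0 T_semigroup), norm_minus_self.
Qed.

Lemma semigroup_orbit_continuous x : continuous_on_halfline (fun t => T t x).
Proof.
apply continuous_on_halfline_iff; intros t Ht eta Heta.
set (B := (M + 1) * exp (Rabs omega * (t + 1))).
assert (HB : 0 < B) by (apply Rmult_lt_0_compat; [lra|apply exp_pos]).
destruct (@semigroup_right_continuous x (eta / B)) as [r [Hr K]];
  [now apply Rdiv_lt_0_compat|].
assert (Main : forall a b, 0 <= a <= b -> a <= t + 1 -> b - a < r ->
  norm (minus (T b x) (T a x)) < eta).
{ intros a b Hab Ha Hr'.
  replace b with (a + (b - a)) by ring.
  rewrite (semigroup_plus T_semigroup) by lra.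
  apply (Rle_lt_trans _ _ _ (@semigroup_lipschitz (t + 1) a _ _ ltac:(lra))); fold B.
  replace eta with (B * (eta / B)) by (field; lra).
  apply Rmult_lt_compat_l; trivial; apply K; lra. }
exists (Rmin r 1); split; [apply Rmin_pos; lra|]; intros s Hs Hst.
apply Rmin_Rgt_l in Hst; destruct Hst as [H1 H2].
apply Rabs_def2 in H1; apply Rabs_def2 in H2.
destruct (Rle_dec s t); [rewrite norm_minus_sym|]; apply Main; lra.
Qed.

Lemma orbit_continuous_domain d : continuous_on_halfline (fun t => T1 t d).
Proof.
apply continuous_on_halfline_iff; intros t Ht eta Heta.
destruct (proj1 (continuous_on_halfline_iff _)
  (semigroup_orbit_continuous (op A (emb d))) t Ht eta Heta) as [r [Hr K]].
exists r; split; trivial; intros s Hs Hst.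
rewrite norm_minus_domain, !op_T1 by trivial; auto.
Qed.

(** Two solutions of the inhomogeneous problem differ by a solution [z] of the
    homogeneous one, and then [T (t - s) (z s)] does not depend on [s]. *)
Lemma linear_cauchy_unique (u v : R -> X1) (h : R -> X) :
  continuous_on_halfline u -> continuous_on_halfline v -> u 0 = v 0 ->
  has_derivative_on_halfline (fun t => emb (u t)) (fun t => plus (op A (emb (u t))) (h t)) ->
  has_derivative_on_halfline (fun t => emb (v t)) (fun t => plus (op A (emb (v t))) (h t)) ->
  forall t, 0 <= t -> u t = v t.
Proof.
intros Hu Hv H0 Du Dv t Ht.
assert (Ce : forall w : R -> X1, continuous_on_halfline w ->
  continuous_on_halfline (fun s => emb (w s))).
{ intros w; apply continuous_on_halfline_linear, emb_linear. }
apply Ce in Hu; apply Ce in Hv.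
rewrite continuous_on_halfline_iff in Hu, Hv.
rewrite has_derivative_on_halfline_iff in Du, Dv.
set (z := fun s => minus (u s) (v s)).
set (chi := fun s => T (t - s) (emb (z s))).
set (B := (M + 1) * exp (Rabs omega * t)).
assert (HB : 0 < B) by (apply Rmult_lt_0_compat; [lra|apply exp_pos]).
assert (HT : forall s x y, 0 <= s <= t ->
  norm (minus (T s x) (T s y)) <= B * norm (minus x y))
  by (intros; now apply semigroup_lipschitz).
assert (H : norm (minus (chi t) (chi 0)) <= 0 * (t - 0)).
{ apply mean_value_inequality; trivial; [lra| |].
  - intros s Hs eta Heta.
    destruct (Hu s ltac:(lra) (eta / (4 * B))) as [r1 [Hr1 H1]];
      [apply Rdiv_lt_0_compat; lra|].
    destruct (Hv s ltac:(lra) (eta / (4 * B))) as [r2 [Hr2 H2]];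
      [apply Rdiv_lt_0_compat; lra|].
    destruct (proj1 (continuous_on_halfline_iff _)
      (semigroup_orbit_continuous (emb (z s))) (t - s) ltac:(lra) (eta / 2) ltac:(lra))
      as [r3 [Hr3 H3]].
    exists (Rmin r1 (Rmin r2 r3)); split; [now repeat apply Rmin_pos|].
    intros s' Hs' Hr.
    assert (Hss : Rabs (s' - s) = s - s') by (rewrite Rabs_minus_sym; apply Rabs_pos_eq; lra).
    assert (Hr' : Rabs (s' - s) < Rmin r1 (Rmin r2 r3)) by lra.
    apply Rmin_Rgt_l in Hr'; destruct Hr' as [R1 R2].
    apply Rmin_Rgt_l in R2; destruct R2 as [R2 R3].
    rewrite norm_minus_sym.
    specialize (H1 s' ltac:(lra) R1); specialize (H2 s' ltac:(lra) R2).
    specialize (H3 (t - s') ltac:(lra)).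
    replace (t - s' - (t - s)) with (- (s' - s)) in H3 by ring.
    rewrite Rabs_Ropp in H3; specialize (H3 R3).
    generalize (norm_minus_triangle (T (t - s') (emb (z s))) (chi s') (chi s)).
    generalize (HT (t - s') (emb (z s')) (emb (z s)) ltac:(lra)); fold (chi s').
    change (T (t - s) (emb (z s))) with (chi s) in H3.
    assert (Hz : norm (minus (emb (z s')) (emb (z s))) <=
      norm (minus (emb (u s')) (emb (u s))) + norm (minus (emb (v s')) (emb (v s)))).
    { unfold z; rewrite !emb_minus.
      vreplace (minus (minus (emb (u s')) (emb (v s'))) (minus (emb (u s)) (emb (v s))))
        with (minus (minus (emb (u s')) (emb (u s))) (minus (emb (v s')) (emb (v s)))).
      apply norm_minus_le. }
    assert (B * (eta / (4 * B)) = eta / 4) by (field; lra).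
    canon; nra.
  - intros s Hs eta Heta.
    assert (He : 0 < eta / (3 * B)) by (apply Rdiv_lt_0_compat; lra).
    destruct (Du s ltac:(lra) _ He) as [r1 [Hr1 H1]].
    destruct (Dv s ltac:(lra) _ He) as [r2 [Hr2 H2]].
    destruct (proj1 (generates_iff (emb (z s)) (op A (emb (z s))))
      (conj (dom_emb _) eq_refl) _ He) as [r3 [Hr3 H3]].
    exists (Rmin r1 (Rmin r2 r3)); split; [now repeat apply Rmin_pos|].
    intros s' Hs' Hst.
    assert (Hss : Rabs (s' - s) = s' - s) by (apply Rabs_pos_eq; lra).
    assert (Hr' : Rabs (s' - s) < Rmin r1 (Rmin r2 r3)) by lra.
    apply Rmin_Rgt_l in Hr'; destruct Hr' as [R1 R2].
    apply Rmin_Rgt_l in R2; destruct R2 as [R2 R3].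
    specialize (H1 s' ltac:(lra) R1); specialize (H2 s' ltac:(lra) R2).
    specialize (H3 (s' - s) ltac:(lra)); rewrite Hss in *.
    assert (Hchi : chi s = T (t - s') (T (s' - s) (emb (z s)))).
    { unfold chi; rewrite <- (semigroup_plus T_semigroup) by lra; f_equal; ring. }
    rewrite Hchi; unfold chi at 1.
    apply (Rle_trans _ _ _ (HT (t - s') _ _ ltac:(lra))).
    match type of H1 with norm ?a <= _ => set (a1 := a) in * end.
    match type of H2 with norm ?a <= _ => set (a2 := a) in * end.
    match type of H3 with norm ?a <= _ => set (a3 := a) in * end.
    vreplace (minus (emb (z s')) (T (s' - s) (emb (z s)))) with
      (minus (minus a1 a2) a3) by (unfold a1, a2, a3, z; rewrite op_minus, !emb_minus; vec).
    generalize (norm_minus_le (minus a1 a2) a3) (norm_minus_le a1 a2).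
    assert (B * (eta / (3 * B)) = eta / 3) by (field; lra).
    canon; nra. }
assert (Hchi0 : chi 0 = zero).
{ assert (Hz0 : emb (z 0) = zero) by (unfold z; rewrite emb_minus, H0; vec).
  unfold chi; rewrite Hz0.
  apply (linear_zero (T (t - 0))), (semigroup_linear T_semigroup); lra. }
assert (Hchit : chi t = minus (emb (u t)) (emb (v t))).
{ unfold chi; rewrite Rminus_diag, (semigroup_0 T_semigroup); apply emb_minus. }
apply emb_inj.
vreplace (emb (u t)) with (plus (minus (chi t) (chi 0)) (emb (v t)))
  by (rewrite Hchi0, Hchit; vec).
rewrite (norm_eq_zero (minus (chi t) (chi 0))), plus_zero_l; trivial.
generalize (norm_ge_0 (minus (chi t) (chi 0))); lra.
Qed.

End Semigroup.

Arguments T1 {X} T {X1} t d.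

(** * Riemann integrals and roots *)

Lemma Riemann_sum_linear {U V : Normed} (l : U -> V) (f : R -> U) ptd :
  is_linear l -> l (Riemann_sum f ptd) = Riemann_sum (fun t => l (f t)) ptd.
Proof.
intros Hl; induction ptd as [x0|x0 s IH] using SF_cons_ind.
- apply (linear_zero l Hl).
- rewrite !Riemann_sum_cons, <- IH.
  refine (eq_trans (linear_plus l Hl _ _) _).
  apply (f_equal (fun v => plus v _)), (linear_scal l Hl).
Qed.

Lemma is_RInt_linear {U V : Normed} (l : U -> V) (f : R -> U) a b y :
  is_linear l -> is_RInt f a b y -> is_RInt (fun t => l (f t)) a b (l y).
Proof.
intros Hl Hf; unfold is_RInt in *.
apply (filterlim_ext (fun ptd => l (scal (sign (b - a)) (Riemann_sum f ptd)))).
- intros ptd; rewrite <- (Riemann_sum_linear l f ptd Hl).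
  apply (linear_scal l Hl).
- apply (filterlim_comp _ _ _ _ l _ (locally y)); trivial.
  now apply (linear_cont l).
Qed.

(** The [p]-th root, extended by [0] to negative numbers. *)
Definition root (p : nat) (t : R) : R :=
  if Rle_dec t 0 then 0 else Rpower t (/ INR p).

Lemma root_nonneg p t : 0 <= root p t.
Proof.
unfold root; destruct (Rle_dec t 0); [lra|]; left; apply exp_pos.
Qed.

Lemma root_pow n t : 0 <= t -> root (S n) t ^ S n = t.
Proof.
intros Ht; unfold root; destruct (Rle_dec t 0) as [H|H].
- rewrite pow_i by lia; lra.
- rewrite <- Rpower_pow by apply exp_pos.
  rewrite Rpower_mult, Rinv_l by (apply not_0_INR; lia).
  apply Rpower_1; lra.
Qed.

Lemma pow_lt_compat n x y : 0 <= x < y -> x ^ S n < y ^ S n.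
Proof.
intros [Hx Hxy]; induction n as [|n IH]; [simpl; lra|].
change (x * x ^ S n < y * y ^ S n).
assert (0 <= x ^ S n) by now apply pow_le.
nra.
Qed.

Lemma pow_le_inv n x y : 0 <= y -> x ^ S n <= y ^ S n -> x <= y.
Proof.
intros Hy H; apply Rnot_lt_le; intros C.
generalize (@pow_lt_compat n y x (conj Hy C)); lra.
Qed.

Lemma pow_add_le n x y : 0 <= x -> 0 <= y -> x ^ S n + y ^ S n <= (x + y) ^ S n.
Proof.
intros Hx Hy; induction n as [|n IH]; [simpl; lra|].
change (x * x ^ S n + y * y ^ S n <= (x + y) * (x + y) ^ S n).
assert (0 <= x ^ S n) by now apply pow_le.
assert (0 <= y ^ S n) by now apply pow_le.
nra.
Qed.

(** The root inherits uniform continuity from [x ^ p + y ^ p <= (x + y) ^ p]. *)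
Lemma root_close n eta s t : 0 < eta -> 0 <= s -> 0 <= t ->
  Rabs (s - t) < eta ^ S n -> Rabs (root (S n) s - root (S n) t) <= eta.
Proof.
intros Heta.
assert (Main : forall a b, 0 <= a -> 0 <= b -> b - a < eta ^ S n ->
  root (S n) b <= root (S n) a + eta).
{ intros a b Ha Hb Hab; assert (Hr := root_nonneg (S n) a).
  apply (@pow_le_inv n); [lra|].
  generalize (@pow_add_le n (root (S n) a) eta Hr ltac:(lra)).
  rewrite !root_pow by trivial; lra. }
intros Hs Ht Hst; apply Rabs_def2 in Hst; apply Rabs_le.
generalize (Main s t Hs Ht) (Main t s Ht Hs); lra.
Qed.

Lemma root_le n s t : 0 <= s <= t -> root (S n) s <= root (S n) t.
Proof.
intros H; apply (@pow_le_inv n); [apply root_nonneg|].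
rewrite !root_pow; lra.
Qed.

Lemma pow_ge_square n x : (1 <= n)%nat -> 0 <= x -> x ^ 2 - 1 <= x ^ S n.
Proof.
intros Hn Hx; destruct (Rle_dec x 1) as [H|H].
- assert (0 <= x ^ S n) by now apply pow_le.
  assert (x ^ 2 <= 1) by (simpl; nra); lra.
- assert (x ^ 2 <= x ^ S n) by (apply Rle_pow; [lra|lia]); lra.
Qed.

Lemma is_RInt_gauss r b :
  r <> 0 ->
  is_RInt (fun s => s * exp (- (s / r) ^ 2)) 0 b
    (r ^ 2 / 2 * (1 - exp (- (b / r) ^ 2))).
Proof.
intros Hr.
set (F := fun s => - (r ^ 2 / 2) * exp (- (s / r) ^ 2)).
replace (r ^ 2 / 2 * (1 - exp (- (b / r) ^ 2))) with (minus (F b) (F 0)).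
2:{ unfold F, minus, plus, opp; simpl.
    replace (- (0 / r * (0 / r * 1))) with 0 by (field; trivial); rewrite exp_0; ring. }
apply (@is_RInt_derive R_CompleteNormedModule F).
- intros x _; unfold F; auto_derive; trivial.
  change (exp (- (x * / r * (x * / r * 1)))) with (exp (- (x / r) ^ 2)).
  set (E := exp _); clearbody E; field; trivial.
- intros x _; apply (ex_derive_continuous (K := R_AbsRing) (V := R_NormedModule)).
  now auto_derive.
Qed.

(** * The inhomogeneous problem *)

Section Duhamel.
Context {X : Banach} {A : operator X} {T : R -> X -> X}
  (T_semigroup : C0_semigroup T) (T_gen : generates A T)
  (A_resolvent : zero_in_resolvent_set A)
  {X1 : banach_in X} (X1_dom : domain_space A X1)
  {M omega : R} (M_pos : 0 < M)
  (T_X1 : forall t, 0 < t -> maps X1 X1 (T t) (M * exp (omega * t)))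
  {Z : banach_in X} {gamma C : R} (gamma_le_1 : gamma <= 1) (C_pos : 0 < C)
  (T_Z : forall t, 0 < t ->
     maps Z X1 (T t) (C * Rpower t (gamma - 1) * exp (omega * t)))
  {n : nat} (n_gamma : 2 <= INR (S n) * gamma).

Let T_orbit := semigroup_orbit_continuous T_semigroup T_gen A_resolvent X1_dom
  M_pos T_X1.
Let T_lipschitz := semigroup_lipschitz T_semigroup T_gen A_resolvent X1_dom
  M_pos T_X1.

Lemma exponent_pos : (1 <= n)%nat.
Proof.
destruct n; [|lia].
simpl in n_gamma; lra.
Qed.

Lemma smoothing_domain t (z : Z) : 0 < t -> dom A (T t (emb z)).
Proof.
intros Ht; destruct (T_Z t Ht z) as [y [Hy _]].
apply (proj1 X1_dom); now exists y.
Qed.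

Lemma smoothing_bound t (z : Z) : 0 < t ->
  norm (lift (T t (emb z)) : X1) <=
    C * Rpower t (gamma - 1) * exp (omega * t) * norm z.
Proof.
intros Ht; destruct (T_Z t Ht z) as [y [Hy Hn]].
now rewrite <- Hy, (lift_emb X1_dom).
Qed.

(** The kernel of the convolution after the substitution [s = tau ^ p], with
    [p = S n] so large that the singularity at [0] disappears. *)
Definition kernel (tau : R) (z : Z) : X1 :=
  if Rle_dec tau 0 then zero
  else scal (INR (S n) * tau ^ n) (lift (T (tau ^ S n) (emb z))).

Lemma kernel_nonpos tau z : tau <= 0 -> kernel tau z = zero.
Proof. intros H; unfold kernel; now destruct (Rle_dec tau 0). Qed.

Lemma kernel_pos tau z : 0 < tau ->
  kernel tau z = scal (INR (S n) * tau ^ n) (lift (T (tau ^ S n) (emb z))).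
Proof. intros H; unfold kernel; destruct (Rle_dec tau 0); [lra|reflexivity]. Qed.

Lemma emb_kernel tau z : 0 < tau ->
  emb (kernel tau z) = scal (INR (S n) * tau ^ n) (T (tau ^ S n) (emb z)).
Proof.
intros H; rewrite kernel_pos by trivial.
refine (eq_trans (linear_scal emb (emb_linear X1) _ _) _).
now rewrite (emb_lift X1_dom) by (apply smoothing_domain, pow_lt, H).
Qed.

Lemma kernel_minus tau y z :
  kernel tau (minus y z) = minus (kernel tau y) (kernel tau z).
Proof.
destruct (Rle_dec tau 0) as [H|H].
- rewrite !kernel_nonpos by trivial; vec.
- apply Rnot_le_lt in H; apply emb_inj.
  rewrite emb_minus, !emb_kernel, emb_minus by trivial.
  rewrite (semigroup_minus T_semigroup) by (apply pow_le; lra); vec.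
Qed.

Let c := INR (S n) * C.
Let w := Rabs omega + 1.

Lemma kernel_constant_pos : 0 < c.
Proof. apply Rmult_lt_0_compat; trivial; apply lt_0_INR; lia. Qed.

(** The exponent [p gamma - 1] on the left lies between [1] and [p]: the first bound
    makes the kernel vanish at [0], the second lets [exp (tau ^ p)] absorb its growth. *)
Lemma smoothed_power_le tau : 0 < tau ->
  tau ^ n * Rpower (tau ^ S n) (gamma - 1) <= tau * exp (tau ^ S n).
Proof.
intros Ht.
rewrite <- !Rpower_pow, Rpower_mult, <- Rpower_plus by trivial.
replace (INR n + INR (S n) * (gamma - 1)) with (INR (S n) * gamma - 1)
  by (rewrite S_INR; ring).
set (a := INR (S n) * gamma - 1).
assert (Ha : 1 <= a <= INR (S n)).
{ unfold a; split; [lra|].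
  assert (0 < INR (S n)) by (apply lt_0_INR; lia); nra. }
destruct (Rle_dec tau 1) as [H1|H1].
- apply (Rle_trans _ (tau * 1)).
  + rewrite Rmult_1_r; rewrite <- (Rpower_1 tau) at 2 by trivial.
    apply exp_le; destruct (Req_dec tau 1) as [->|Hne]; [rewrite ln_1; lra|].
    assert (ln tau < 0) by (rewrite <- ln_1; apply ln_increasing; lra).
    nra.
  + apply Rmult_le_compat_l; [lra|]; rewrite <- exp_0 at 1; apply exp_le.
    left; apply exp_pos.
- apply (Rle_trans _ (Rpower tau (INR (S n)))).
  + apply Rle_Rpower; lra.
  + generalize (exp_ineq1_le (Rpower tau (INR (S n)))) (exp_pos (INR (S n) * ln tau)).
    unfold Rpower; nra.
Qed.

Lemma kernel_bound tau z : 0 <= tau ->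
  norm (kernel tau z) <= c * tau * exp (w * tau ^ S n) * norm z.
Proof.
intros Ht; destruct (Req_dec tau 0) as [->|Hne].
{ rewrite kernel_nonpos by lra; canon; rewrite norm_zero; lra. }
assert (H : 0 < tau) by lra.
rewrite kernel_pos by trivial.
refine (Rle_trans _ _ _ (Req_le _ _ (norm_scal_R _ _)) _).
assert (Hp : 0 < tau ^ S n) by now apply pow_lt.
assert (Hn : 0 <= INR (S n) * tau ^ n).
{ apply Rmult_le_pos; [apply pos_INR|]; now apply pow_le; lra. }
rewrite Rabs_pos_eq by trivial.
apply (Rle_trans _ _ _ (Rmult_le_compat_l _ _ _ Hn (smoothing_bound (tau ^ S n) z Hp))).
rewrite <- Rmult_assoc; apply Rmult_le_compat_r; [apply norm_ge_0|].
unfold c, w; rewrite Rmult_plus_distr_r, Rmult_1_l, exp_plus.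
replace (INR (S n) * tau ^ n * (C * Rpower (tau ^ S n) (gamma - 1) *
  exp (omega * tau ^ S n))) with
  (INR (S n) * C * ((tau ^ n * Rpower (tau ^ S n) (gamma - 1)) *
     exp (omega * tau ^ S n))) by ring.
replace (INR (S n) * C * tau * (exp (Rabs omega * tau ^ S n) * exp (tau ^ S n))) with
  (INR (S n) * C * ((tau * exp (tau ^ S n)) * exp (Rabs omega * tau ^ S n))) by ring.
apply Rmult_le_compat_l; [left; apply kernel_constant_pos|].
apply Rmult_le_compat.
- apply Rmult_le_pos; [apply pow_le; lra|left; apply exp_pos].
- left; apply exp_pos.
- now apply smoothed_power_le.
- apply exp_le, Rmult_le_compat_r; [lra|apply Rle_abs].
Qed.

Lemma kernel_le b tau z : 0 <= b -> tau <= b ->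
  norm (kernel tau z) <= c * b * exp (w * b ^ S n) * norm z.
Proof.
intros Hb Htau; assert (Hc := kernel_constant_pos).
assert (Hw : 0 <= w) by (generalize (Rabs_pos omega); unfold w; lra).
destruct (Rle_dec tau 0) as [H|H].
- rewrite kernel_nonpos by trivial; canon; rewrite norm_zero.
  apply Rmult_le_pos; [|apply norm_ge_0].
  apply Rmult_le_pos; [nra|left; apply exp_pos].
- apply (Rle_trans _ _ _ (kernel_bound tau z ltac:(lra))).
  apply Rmult_le_compat_r; [apply norm_ge_0|].
  apply Rmult_le_compat; [nra|left; apply exp_pos|nra|].
  apply exp_le, Rmult_le_compat_l; trivial; apply pow_incr; lra.
Qed.

(** After any positive time the orbit of [z] is an orbit in [X1]. *)
Lemma smoothed_orbit_continuous (z : Z) t : 0 < t ->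
  continuous (fun s => lift (T s (emb z)) : X1) t.
Proof.
intros Ht.
set (d := lift (T (t / 2) (emb z)) : X1).
assert (Hd : emb d = T (t / 2) (emb z))
  by (apply (emb_lift X1_dom), smoothing_domain; lra).
apply (continuous_ext_loc _ (fun s => T1 T (Rmax 0 (s - t / 2)) d)).
- apply locally_iff; exists (t / 2); split; [lra|]; intros s Hs.
  apply Rabs_def2 in Hs; rewrite Rmax_right by lra.
  unfold T1; rewrite Hd, <- (semigroup_plus T_semigroup) by lra.
  now replace (s - t / 2 + t / 2) with s by ring.
- apply (continuous_comp (fun s => s - t / 2) (fun s => T1 T (Rmax 0 s) d)).
  + apply (ex_derive_continuous (K := R_AbsRing) (V := R_NormedModule)); now auto_derive.
  + apply (continuous_halfline_extension (fun s => T1 T s d)).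
    apply (orbit_continuous_domain T_semigroup T_gen A_resolvent X1_dom M_pos T_X1).
Qed.

Lemma pow_continuous k t : continuous (fun s : R => s ^ k) t.
Proof.
apply (ex_derive_continuous (K := R_AbsRing) (V := R_NormedModule)); now auto_derive.
Qed.

Lemma kernel_continuous (z : Z) tau : 0 < tau -> continuous (fun s => kernel s z) tau.
Proof.
intros Ht.
apply (continuous_ext_loc _
  (fun s => scal (INR (S n) * s ^ n) (lift (T (s ^ S n) (emb z)) : X1))).
- apply locally_iff; exists tau; split; trivial; intros s Hs.
  apply Rabs_def2 in Hs; now rewrite kernel_pos by lra.
- apply (continuous_scal (V := X1)).
  + apply (ex_derive_continuous (K := R_AbsRing) (V := R_NormedModule)); now auto_derive.
  + apply (continuous_comp (fun s => s ^ S n) (fun s => lift (T s (emb z)) : X1)).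
    * apply pow_continuous.
    * apply smoothed_orbit_continuous, pow_lt, Ht.
Qed.

Lemma integrand_continuous (h : R -> Z) (t tau : R) :
  (forall s, continuous h s) ->
  continuous (fun s => kernel s (h (t - s ^ S n))) tau.
Proof.
intros Hh.
assert (Hc : forall s, continuous (fun s => h (t - s ^ S n)) s).
{ intros s; apply (continuous_comp (fun s => t - s ^ S n) h); trivial.
  apply (ex_derive_continuous (K := R_AbsRing) (V := R_NormedModule)); now auto_derive. }
destruct (Rle_dec tau 0) as [H|H].
- destruct (bounded_continuity (fun s => h (t - s ^ S n)) 0 1) as [H0 HH0];
    [intros; apply Hc|].
  assert (Hw : 0 <= w) by (generalize (Rabs_pos omega); unfold w; lra).
  assert (Hcc := kernel_constant_pos).
  assert (HH : 0 < H0) by (generalize (norm_ge_0 (h (t - 0 ^ S n))) (HH0 0 ltac:(lra)); lra).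
  apply (proj2 (continuous_iff (V := X1) (fun s => kernel s (h (t - s ^ S n))) tau)).
  intros eta Heta; set (B := c * exp w * H0).
  assert (HB : 0 < B) by (apply Rmult_lt_0_compat; trivial; apply Rmult_lt_0_compat; trivial; apply exp_pos).
  exists (Rmin 1 (eta / B)); split.
  { apply Rmin_pos; [lra|now apply Rdiv_lt_0_compat]. }
  intros s Hs; apply Rmin_Rgt_l in Hs; destruct Hs as [Hs1 Hs2].
  rewrite (kernel_nonpos tau) by trivial.
  apply (Rle_lt_trans _ (norm (kernel s (h (t - s ^ S n))))); [right; f_equal; vec|].
  destruct (Rle_dec s 0) as [Hs0|Hs0].
  + rewrite kernel_nonpos by trivial; canon; now rewrite norm_zero.
  + apply Rabs_def2 in Hs1; apply Rabs_def2 in Hs2.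
    apply (Rle_lt_trans _ (B * s)).
    * apply (Rle_trans _ _ _ (kernel_bound s _ ltac:(lra))).
      replace (B * s) with (c * s * exp w * H0) by (unfold B; ring).
      apply Rmult_le_compat.
      -- apply Rmult_le_pos; [nra|left; apply exp_pos].
      -- apply norm_ge_0.
      -- apply Rmult_le_compat_l; [nra|]; apply exp_le.
         rewrite <- (Rmult_1_r w) at 2; apply Rmult_le_compat_l; trivial.
         rewrite <- (pow1 (S n)); apply pow_incr; lra.
      -- left; apply HH0; lra.
    * replace eta with (B * (eta / B)) by (field; lra).
      apply Rmult_lt_compat_l; lra.
- apply Rnot_le_lt in H.
  apply (continuous_apply kernel _ tau 1 (c * (tau + 1) * exp (w * (tau + 1) ^ S n)));
    [lra| |now apply kernel_continuous|apply Hc].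
  intros s Hs x y; rewrite <- kernel_minus; apply Rabs_def2 in Hs.
  apply kernel_le; lra.
Qed.

(** The mild solution with zero initial value, [int_0^t T (s) h (t - s) ds], as an
    integral in [X1]. *)
Definition duhamel (h : R -> Z) (t : R) : X1 :=
  RInt (fun tau => kernel tau (h (t - tau ^ S n))) 0 (root (S n) t).

Lemma integrand_integrable (h : R -> Z) t a b : (forall s, continuous h s) ->
  ex_RInt (fun tau => kernel tau (h (t - tau ^ S n))) a b.
Proof. intros Hh; apply ex_RInt_continuous; intros; now apply integrand_continuous. Qed.

Lemma duhamel_0 h : duhamel h 0 = zero.
Proof.
unfold duhamel, root; destruct (Rle_dec 0 0); [apply RInt_point|lra].
Qed.

(** [tau ^ p / r ^ p >= (tau / r) ^ 2 - 1] turns the weight into a Gaussian, the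
    integral of which against [tau] is explicit and of order [r ^ 2]. *)
Lemma weighted_kernel_le r lambda tau : 0 < r -> 0 <= tau -> w + / r ^ S n <= lambda ->
  tau * exp (w * tau ^ S n) * exp (- (lambda * tau ^ S n)) <=
    exp 1 * (tau * exp (- (tau / r) ^ 2)).
Proof.
intros Hr Ht Hl.
assert (Hp : 0 <= tau ^ S n) by now apply pow_le.
assert (Hq : (tau / r) ^ 2 - 1 <= (tau / r) ^ S n).
{ apply pow_ge_square; [apply exponent_pos|].
  apply Rmult_le_pos; trivial; left; now apply Rinv_0_lt_compat. }
unfold Rdiv in Hq at 2; rewrite Rpow_mult_distr, pow_inv in Hq.
replace (exp 1 * (tau * exp (- (tau / r) ^ 2))) with
  (tau * (exp 1 * exp (- (tau / r) ^ 2))) by ring.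
rewrite Rmult_assoc, <- !exp_plus; apply Rmult_le_compat_l; trivial.
apply exp_le; nra.
Qed.

(** The convolution is a contraction in the norm [sup exp (- lambda t) |h t|] for
    large [lambda], with a bound at time [t] that only involves the past of [t]. *)
Lemma duhamel_contraction q : 0 < q -> exists lambda0, forall lambda, lambda0 <= lambda ->
  forall h k : R -> Z, (forall s, continuous h s) -> (forall s, continuous k s) ->
  forall K t, 0 <= K -> 0 <= t ->
  (forall s, 0 <= s <= t -> norm (minus (h s) (k s)) <= K * exp (lambda * s)) ->
  norm (minus (duhamel h t) (duhamel k t)) <= q * K * exp (lambda * t).
Proof.
intros Hq; assert (Hc := kernel_constant_pos).
assert (He := exp_pos 1).
assert (Hce : 0 < c * exp 1) by now apply Rmult_lt_0_compat.
set (r := Rmin 1 (2 * q / (c * exp 1))).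
assert (Hr : 0 < r) by (apply Rmin_pos; [lra|apply Rdiv_lt_0_compat; lra]).
assert (Hrq : c * exp 1 * (r ^ 2 / 2) <= q).
{ apply (Rle_trans _ (c * exp 1 * (2 * q / (c * exp 1) / 2))); [|right; field; lra].
  apply Rmult_le_compat_l; [lra|].
  generalize (Rmin_l 1 (2 * q / (c * exp 1))) (Rmin_r 1 (2 * q / (c * exp 1))).
  fold r; intros H1 H2; simpl; nra. }
exists (w + / r ^ S n); intros lambda Hl h k Hh Hk K t HK Ht Hhk.
assert (Hrt := root_nonneg (S n) t).
unfold duhamel.
apply (Rle_trans _ (c * K * exp (lambda * t) * exp 1 *
  (r ^ 2 / 2 * (1 - exp (- (root (S n) t / r) ^ 2))))).
- refine (norm_RInt_le _ (fun tau => c * K * exp (lambda * t) * exp 1 *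
    (tau * exp (- (tau / r) ^ 2))) _ _ _ _ Hrt _ _ _).
  2:{ apply (is_RInt_minus (V := X1)); apply RInt_correct; now apply integrand_integrable. }
  2:{ apply (is_RInt_scal (V := R_NormedModule)), is_RInt_gauss; lra. }
  intros tau Htau; simpl.
  rewrite <- kernel_minus.
  assert (Hp : 0 <= tau ^ S n) by now apply pow_le.
  assert (Hpt : tau ^ S n <= t).
  { rewrite <- (root_pow n t) by trivial; apply pow_incr; lra. }
  apply (Rle_trans _ _ _ (kernel_bound tau _ ltac:(lra))).
  apply (Rle_trans _ (c * tau * exp (w * tau ^ S n) * (K * exp (lambda * (t - tau ^ S n))))).
  + apply Rmult_le_compat_l.
    * apply Rmult_le_pos; [nra|left; apply exp_pos].
    * apply Hhk; lra.
  + replace (lambda * (t - tau ^ S n)) with (lambda * t + - (lambda * tau ^ S n)) by ring.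
    rewrite exp_plus.
    replace (c * tau * exp (w * tau ^ S n) *
      (K * (exp (lambda * t) * exp (- (lambda * tau ^ S n))))) with
      (c * K * exp (lambda * t) *
        (tau * exp (w * tau ^ S n) * exp (- (lambda * tau ^ S n)))) by ring.
    rewrite (Rmult_assoc _ (exp 1)).
    apply Rmult_le_compat_l; [|apply weighted_kernel_le; lra].
    apply Rmult_le_pos; [nra|left; apply exp_pos].
- assert (0 <= K * exp (lambda * t)) by (apply Rmult_le_pos; trivial; left; apply exp_pos).
  assert (0 < exp (- (root (S n) t / r) ^ 2)) by apply exp_pos.
  replace (c * K * exp (lambda * t) * exp 1 *
    (r ^ 2 / 2 * (1 - exp (- (root (S n) t / r) ^ 2)))) with
    (K * exp (lambda * t) * (c * exp 1 * (r ^ 2 / 2) *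
      (1 - exp (- (root (S n) t / r) ^ 2)))) by ring.
  replace (q * K * exp (lambda * t)) with (K * exp (lambda * t) * q) by ring.
  apply Rmult_le_compat_l; trivial.
  assert (0 <= c * exp 1 * (r ^ 2 / 2)).
  { apply Rmult_le_pos; [lra|]; assert (0 < r ^ 2) by now apply pow_lt.
    lra. }
  nra.
Qed.

Lemma duhamel_continuous (h : R -> Z) : (forall s, continuous h s) ->
  continuous_on_halfline (duhamel h).
Proof.
intros Hh; apply continuous_on_halfline_iff; intros t Ht eta Heta.
assert (Hc := kernel_constant_pos).
set (b := root (S n) (t + 1)).
assert (Hb : 0 <= b) by apply root_nonneg.
set (B := c * b * exp (w * b ^ S n)).
assert (HB : 0 <= B) by (apply Rmult_le_pos; [nra|left; apply exp_pos]).
destruct (bounded_continuity h (-1) (t + 1)) as [H0 HH0]; [intros; apply Hh|].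
assert (HH : 0 < H0) by (generalize (norm_ge_0 (h 0)) (HH0 0 ltac:(lra)); lra).
set (e1 := eta / (4 * (B + 1) * (b + 1))).
assert (He1 : 0 < e1) by (apply Rdiv_lt_0_compat; nra).
destruct (unifcont_normed_1d h (-1) (t + 1) ltac:(intros; apply Hh) (mkposreal e1 He1))
  as [r1 Hr1].
set (e2 := eta / (4 * (B + 1) * H0)).
assert (He2 : 0 < e2) by (apply Rdiv_lt_0_compat; nra).
assert (He2p : 0 < e2 ^ S n) by now apply pow_lt.
exists (Rmin 1 (Rmin r1 (e2 ^ S n))); split.
{ repeat apply Rmin_pos; trivial; [lra|apply cond_pos]. }
intros s Hs Hst.
apply Rmin_Rgt_l in Hst; destruct Hst as [H1 Hst].
apply Rmin_Rgt_l in Hst; destruct Hst as [H2 H3].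
apply (root_close n e2 s t He2 Hs Ht) in H3.
assert (H1' := Rabs_def2 _ _ H1).
assert (Hrs : root (S n) s <= b) by (apply root_le; lra).
assert (Hrt : root (S n) t <= b) by (apply root_le; lra).
assert (Hrs0 := root_nonneg (S n) s).
assert (Hrt0 := root_nonneg (S n) t).
set (ks := fun tau => kernel tau (h (s - tau ^ S n))).
set (kt := fun tau => kernel tau (h (t - tau ^ S n))).
assert (Is : forall x y, ex_RInt ks x y) by (intros; now apply integrand_integrable).
assert (It : forall x y, ex_RInt kt x y) by (intros; now apply integrand_integrable).
assert (Hpow : forall tau, 0 <= tau <= Rmax (root (S n) s) (root (S n) t) ->
  0 <= tau ^ S n <= Rmax s t).
{ intros tau Htau; split; [apply pow_le; lra|].
  apply (Rle_trans _ (Rmax (root (S n) s) (root (S n) t) ^ S n)); [apply pow_incr; lra|].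
  apply Rmax_case; rewrite root_pow by trivial; [apply Rmax_l|apply Rmax_r]. }
assert (Hmax : Rmax s t <= t + 1) by (apply Rmax_lub; lra).
change (norm (minus (RInt ks 0 (root (S n) s)) (RInt kt 0 (root (S n) t))) < eta).
(* Change first the argument of [h] and then the end point. *)
assert (D1 : norm (minus (RInt ks 0 (root (S n) t)) (RInt kt 0 (root (S n) t))) <=
  (root (S n) t - 0) * (B * e1)).
{ apply (norm_RInt_le_const (fun tau => minus (ks tau) (kt tau)) 0 (root (S n) t));
    trivial.
  2:{ apply (is_RInt_minus (V := X1)); now apply RInt_correct. }
  intros tau Htau; unfold ks, kt; rewrite <- kernel_minus.
  apply (Rle_trans _ _ _ (kernel_le b tau _ Hb ltac:(lra))); fold B.
  apply Rmult_le_compat_l; trivial; left.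
  assert (Hp : 0 <= tau ^ S n <= t).
  { split; [apply pow_le; lra|].
    rewrite <- (root_pow n t) by trivial; apply pow_incr; lra. }
  refine (Hr1 (t - tau ^ S n) (s - tau ^ S n) _ _ _); [lra|lra|].
  change (Rabs ((s - tau ^ S n) - (t - tau ^ S n)) < r1).
  now replace (s - tau ^ S n - (t - tau ^ S n)) with (s - t) by ring. }
assert (D2 : norm (RInt ks (root (S n) t) (root (S n) s)) <=
  Rabs (root (S n) s - root (S n) t) * (B * H0)).
{ apply (norm_RInt_le_const_abs ks (root (S n) t) (root (S n) s)).
  2: now apply RInt_correct.
  intros tau Htau; unfold ks.
  assert (Htau' : 0 <= tau <= Rmax (root (S n) s) (root (S n) t)).
  { rewrite (Rmax_comm (root (S n) s)); split; [|lra].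
    apply (Rle_trans _ (Rmin (root (S n) t) (root (S n) s))); [|lra].
    now apply Rmin_glb. }
  assert (Htb : tau <= b) by (apply (Rle_trans _ _ _ (proj2 Htau')); now apply Rmax_lub).
  apply (Rle_trans _ _ _ (kernel_le b tau _ Hb Htb)); fold B.
  apply Rmult_le_compat_l; trivial; left; apply HH0.
  specialize (Hpow tau Htau').
  assert (Rmax s t <= s + 1) by (apply Rmax_lub; lra).
  lra. }
rewrite <- (RInt_Chasles ks 0 (root (S n) t) (root (S n) s)) by trivial.
apply (Rle_lt_trans _ (norm (minus (RInt ks 0 (root (S n) t)) (RInt kt 0 (root (S n) t)))
  + norm (RInt ks (root (S n) t) (root (S n) s)))).
{ refine (Rle_trans _ _ _ (Req_le _ _ (f_equal norm _)) (norm_triangle _ _)); vec. }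
assert (E1 : (B + 1) * (b + 1) * e1 = eta / 4) by (unfold e1; field; nra).
assert (E2 : (B + 1) * H0 * e2 = eta / 4) by (unfold e2; field; nra).
assert (F1 : (root (S n) t - 0) * (B * e1) <= eta / 4).
{ rewrite <- E1; replace ((B + 1) * (b + 1) * e1) with ((b + 1) * ((B + 1) * e1)) by ring.
  apply Rmult_le_compat; nra. }
assert (F2 : Rabs (root (S n) s - root (S n) t) * (B * H0) <= eta / 4).
{ rewrite <- E2; replace ((B + 1) * H0 * e2) with (e2 * ((B + 1) * H0)) by ring.
  apply Rmult_le_compat; try nra; apply Rabs_pos. }
lra.
Qed.

Lemma orbit_integrand_continuous (h : R -> Z) (t s : R) : (forall s, continuous h s) ->
  continuous (fun s => T (Rmax 0 s) (emb (h (t - s)))) s.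
Proof.
intros Hh.
apply (continuous_apply (fun s => T (Rmax 0 s)) (fun s => emb (h (t - s))) s 1
  ((M + 1) * exp (Rabs omega * (Rabs s + 1)))); [lra| | |].
- intros s' Hs x y; apply T_lipschitz; split; [apply Rmax_l|].
  apply Rmax_lub; [generalize (Rabs_pos s); lra|].
  apply Rabs_def2 in Hs; generalize (Rle_abs s); lra.
- apply (continuous_halfline_extension (fun s => T s _)), T_orbit.
- apply (continuous_comp (fun s => h (t - s)) emb); [|exact (linear_cont emb _ (emb_linear _))].
  apply (continuous_comp (fun s => t - s) h); trivial.
  apply (ex_derive_continuous (K := R_AbsRing) (V := R_NormedModule)); now auto_derive.
Qed.

Lemma orbit_integrand_integrable (h : R -> Z) t a b : (forall s, continuous h s) ->
  ex_RInt (fun s => T (Rmax 0 s) (emb (h (t - s)))) a b.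
Proof. intros Hh; apply ex_RInt_continuous; intros; now apply orbit_integrand_continuous. Qed.

(** Undoing the substitution [s = tau ^ p], which is possible in [X], where the
    integrand is continuous up to [s = 0]. *)
Lemma emb_duhamel (h : R -> Z) t : (forall s, continuous h s) -> 0 <= t ->
  emb (duhamel h t) = RInt (fun s => T (Rmax 0 s) (emb (h (t - s)))) 0 t.
Proof.
intros Hh Ht.
set (F := fun s => T (Rmax 0 s) (emb (h (t - s)))).
assert (Hr := root_nonneg (S n) t).
transitivity (RInt (fun tau => scal (INR (S n) * tau ^ n) (F (tau ^ S n))) 0 (root (S n) t)).
- symmetry; apply is_RInt_unique.
  apply (is_RInt_ext (fun tau => emb (kernel tau (h (t - tau ^ S n))))).
  + intros tau Htau; rewrite Rmin_left in Htau by trivial.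
    unfold F; rewrite emb_kernel by lra.
    now rewrite Rmax_right by (apply pow_le; lra).
  + apply is_RInt_linear; [apply emb_linear|].
    apply RInt_correct; now apply integrand_integrable.
- replace (RInt F 0 t) with (RInt F (0 ^ S n) (root (S n) t ^ S n))
    by (rewrite root_pow, pow_i by (trivial; lia); reflexivity).
  apply (RInt_comp F (fun tau => tau ^ S n) (fun tau => INR (S n) * tau ^ n)).
  + intros x _; now apply orbit_integrand_continuous.
  + intros x _; split.
    * rewrite <- (Rmult_1_r (INR (S n))).
      apply (is_derive_pow (fun y => y) (S n) x 1), (is_derive_id (K := R_AbsRing)).
    * apply (ex_derive_continuous (K := R_AbsRing) (V := R_NormedModule)); now auto_derive.
Qed.

Section Initial_value.
Context (h : R -> Z) (u0 : X1) (Hh : forall s, continuous h s).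

Definition mild_solution (t : R) : X1 := plus (T1 T t u0) (duhamel h t).

Lemma mild_solution_0 : mild_solution 0 = u0.
Proof.
unfold mild_solution, T1.
rewrite (semigroup_0 T_semigroup), (lift_emb X1_dom), duhamel_0; vec.
Qed.

Lemma mild_solution_continuous : continuous_on_halfline mild_solution.
Proof.
apply (continuous_on_halfline_plus (V := X1) (fun t => T1 T t u0) (duhamel h)).
- apply (orbit_continuous_domain T_semigroup T_gen A_resolvent X1_dom M_pos T_X1).
- now apply duhamel_continuous.
Qed.

(** After time [t] the mild solution restarts from its value at time [t]. *)
Lemma mild_solution_shift t r : 0 <= t -> 0 <= r ->
  emb (mild_solution (t + r)) =
    plus (T r (emb (mild_solution t)))
      (RInt (fun s => T (Rmax 0 s) (emb (h (t + r - s)))) 0 r).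
Proof.
intros Ht Hr; unfold mild_solution.
rewrite !(linear_plus emb (emb_linear X1)).
rewrite !(emb_T1 T_semigroup T_gen X1_dom), !emb_duhamel by (trivial; lra).
rewrite (linear_plus (T r) (semigroup_linear T_semigroup Hr)).
rewrite <- (semigroup_plus T_semigroup), (Rplus_comm r t) by trivial.
rewrite <- (RInt_Chasles _ 0 r (t + r)) by now apply orbit_integrand_integrable.
assert (E : RInt (fun s => T (Rmax 0 s) (emb (h (t + r - s)))) r (t + r) =
  T r (RInt (fun s => T (Rmax 0 s) (emb (h (t - s)))) 0 t)).
{ transitivity (RInt (fun s => scal 1
    (T (Rmax 0 (1 * s + r)) (emb (h (t + r - (1 * s + r)))))) 0 t).
  - rewrite (RInt_comp_lin (fun s => T (Rmax 0 s) (emb (h (t + r - s)))) 1 r 0 t)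
      by now apply orbit_integrand_integrable.
    f_equal; ring.
  - apply is_RInt_unique.
    apply (is_RInt_ext (fun s => T r (T (Rmax 0 s) (emb (h (t - s)))))).
    + intros s Hs; rewrite Rmin_left in Hs by trivial.
      refine (eq_trans _ (eq_sym (scal_one _))).
      rewrite <- (semigroup_plus T_semigroup) by (trivial; apply Rmax_l).
      f_equal; [rewrite !Rmax_right; lra|f_equal; f_equal; ring].
    + apply is_RInt_linear; [now apply semigroup_linear|].
      apply RInt_correct; now apply orbit_integrand_integrable. }
rewrite E; vec.
Qed.

(** In [mild_solution_shift] the difference quotient of the first term tends to
    [A u], because the mild solution takes its values in the domain, and that of the
    second one to [h t]. *)
Lemma mild_solution_right_derivative t : 0 <= t ->
  forall eta, 0 < eta -> exists r, 0 < r /\ forall s, t < s < t + r ->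
    norm (minus (minus (emb (mild_solution s)) (emb (mild_solution t)))
      (scal (s - t) (plus (op A (emb (mild_solution t))) (emb (h t))))) <= eta * (s - t).
Proof.
intros Ht eta Heta.
destruct (proj1 (generates_iff T_gen (emb (mild_solution t)) (op A (emb (mild_solution t))))
  (conj (dom_emb X1_dom _) eq_refl) (eta / 2) ltac:(lra)) as [r1 [Hr1 H1]].
set (B := (M + 1) * exp (Rabs omega * 1)).
assert (HB : 0 < B) by (apply Rmult_lt_0_compat; [lra|apply exp_pos]).
assert (Ce : continuous (fun s => emb (h s)) t).
{ apply (continuous_comp h emb); trivial; exact (linear_cont emb _ (emb_linear _)). }
destruct (proj1 (continuous_iff (V := X) _ _) Ce (eta / (4 * B))) as [r2 [Hr2 H2]];
  [apply Rdiv_lt_0_compat; lra|].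
destruct (semigroup_right_continuous T_semigroup (emb (h t)) (eta / 4) ltac:(lra))
  as [r3 [Hr3 H3]].
exists (Rmin 1 (Rmin r1 (Rmin r2 r3))); split; [repeat apply Rmin_pos; lra|].
intros s Hs.
assert (Hs' : s - t < Rmin 1 (Rmin r1 (Rmin r2 r3))) by lra.
apply Rmin_Rgt_l in Hs'; destruct Hs' as [R0 Hs'].
apply Rmin_Rgt_l in Hs'; destruct Hs' as [R1' Hs'].
apply Rmin_Rgt_l in Hs'; destruct Hs' as [R2 R3].
set (r := s - t) in *.
replace s with (t + r) by (unfold r; ring).
assert (Hr : 0 < r) by (unfold r; lra).
specialize (H1 r ltac:(lra)).
rewrite mild_solution_shift by lra.
set (I := RInt _ 0 r).
assert (HI : norm (minus I (scal (r - 0) (emb (h t)))) <= (r - 0) * (eta / 2)).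
{ apply (norm_RInt_le_const (V := X)
    (fun s => minus (T (Rmax 0 s) (emb (h (t + r - s)))) (emb (h t))) 0 r); [lra| |].
  2:{ apply (is_RInt_minus (V := X)); [|apply (is_RInt_const (V := X))].
      apply RInt_correct; now apply orbit_integrand_integrable. }
  intros x Hx; rewrite Rmax_right by lra.
  apply (Rle_trans _ _ _ (norm_minus_triangle (T x (emb (h t))) _ _)).
  generalize (T_lipschitz 1 x (emb (h (t + r - x))) (emb (h t)) ltac:(lra)); fold B.
  specialize (H3 x ltac:(lra)).
  assert (Hd : Rabs (t + r - x - t) < r2) by (rewrite Rabs_pos_eq; lra).
  specialize (H2 _ Hd).
  assert (B * (eta / (4 * B)) = eta / 4) by (field; lra).
  cbv beta in *; canon; nra. }
rewrite Rminus_0_r in HI.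
match type of H1 with norm ?a <= _ => set (a1 := a) in * end.
match type of HI with norm ?a <= _ => set (a2 := a) in * end.
apply (Rle_trans _ (norm (plus a1 a2))).
- right; f_equal; unfold a1, a2; vec.
- apply (Rle_trans _ _ _ (norm_triangle a1 a2)); lra.
Qed.

Lemma mild_solution_derivative :
  has_derivative_on_halfline (fun t => emb (mild_solution t))
    (fun t => plus (op A (emb (mild_solution t))) (emb (h t))).
Proof.
assert (Hc := mild_solution_continuous).
apply (derivative_of_right_derivative (V := X)); [| |exact mild_solution_right_derivative].
- apply continuous_on_halfline_linear; [apply emb_linear|exact Hc].
- apply continuous_on_halfline_plus; [now apply (op_continuous X1_dom)|].
  apply continuous_on_halfline_linear; [apply emb_linear|].
  intros t _; apply (filterlim_filter_le_1 _ (filter_le_within _)), Hh.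
Qed.

End Initial_value.
End Duhamel.

(** * Solution operators of linear problems *)

(** What the nonlinear problem uses of the linear one.  The contraction property at time
    [t] only involves [s <= t]: it applies also to functions that are not known to grow
    at most like [exp (lambda t)], as is needed for uniqueness. *)
Record solution_operator {X : Normed} (A : operator X) (X1 Z : banach_in X) (u0 : X1)
    (S : (R -> Z) -> R -> X1) : Prop := {
  solution_continuous : forall h, continuous_on_halfline h ->
    continuous_on_halfline (S h);
  solution_initial : forall h, continuous_on_halfline h -> S h 0 = u0;
  solution_derivative : forall h, continuous_on_halfline h ->
    has_derivative_on_halfline (fun t => emb (S h t))
      (fun t => plus (op A (emb (S h t))) (emb (h t)));
  solution_unique : forall h u, continuous_on_halfline h ->
    continuous_on_halfline u -> u 0 = u0 ->
    has_derivative_on_halfline (fun t => emb (u t))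
      (fun t => plus (op A (emb (u t))) (emb (h t))) ->
    forall t, 0 <= t -> u t = S h t;
  solution_contraction : forall q, 0 < q -> exists lambda0,
    forall lambda, lambda0 <= lambda ->
    forall h k, continuous_on_halfline h -> continuous_on_halfline k ->
    forall K t, 0 <= K -> 0 <= t ->
    (forall s, 0 <= s <= t -> norm (minus (h s) (k s)) <= K * exp (lambda * s)) ->
    norm (minus (S h t) (S k t)) <= q * K * exp (lambda * t);
  solution_homogeneous_bound : exists lambda0 K, 0 <= K /\
    forall t, 0 <= t -> norm (S (fun _ => zero) t) <= K * exp (lambda0 * t)
}.

Arguments solution_continuous {X A X1 Z u0 S}.
Arguments solution_initial {X A X1 Z u0 S}.
Arguments solution_derivative {X A X1 Z u0 S}.
Arguments solution_unique {X A X1 Z u0 S}.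
Arguments solution_contraction {X A X1 Z u0 S}.
Arguments solution_homogeneous_bound {X A X1 Z u0 S}.

Lemma exists_exponent gamma : 0 < gamma -> exists n, 2 <= INR (S n) * gamma.
Proof.
intros Hg; destruct (INR_unbounded (2 / gamma)) as [n Hn].
exists n; rewrite S_INR.
assert (2 / gamma * gamma = 2) by (field; lra); nra.
Qed.

Lemma linear_cauchy_problem {X : Banach} (A : operator X) (T : R -> X -> X)
    (X1 Z : banach_in X) (M omega gamma C : R) (u0 : X1) :
  C0_semigroup T -> generates A T -> zero_in_resolvent_set A -> domain_space A X1 ->
  0 < M -> (forall t, 0 < t -> maps X1 X1 (T t) (M * exp (omega * t))) ->
  0 < gamma <= 1 -> 0 < C ->
  (forall t, 0 < t -> maps Z X1 (T t) (C * Rpower t (gamma - 1) * exp (omega * t))) ->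
  exists S, solution_operator A X1 Z u0 S.
Proof.
intros T_semigroup T_gen A_resolvent X1_dom M_pos T_X1 [Hg0 Hg1] C_pos T_Z.
destruct (exists_exponent gamma Hg0) as [n n_gamma].
assert (Hext : forall h : R -> Z, continuous_on_halfline h ->
  forall s, continuous (fun s => h (Rmax 0 s)) s)
  by (intros h H s; exact (continuous_halfline_extension h s H)).
exists (fun h => mild_solution (T := T) (n := n) (fun s => h (Rmax 0 s)) u0).
assert (Hder : forall h : R -> Z, continuous_on_halfline h ->
  has_derivative_on_halfline
    (fun t => emb (mild_solution (T := T) (n := n) (fun s => h (Rmax 0 s)) u0 t))
    (fun t => plus (op A (emb (mild_solution (T := T) (n := n)
       (fun s => h (Rmax 0 s)) u0 t))) (emb (h t)))).
{ intros h Hh t Ht.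
  assert (D := mild_solution_derivative T_semigroup T_gen A_resolvent X1_dom M_pos T_X1
    Hg1 C_pos T_Z n_gamma (fun s => h (Rmax 0 s)) u0 (Hext h Hh) t Ht).
  cbv beta in D; now rewrite (Rmax_right 0 t Ht) in D. }
assert (Hcont : forall h : R -> Z, continuous_on_halfline h ->
  continuous_on_halfline (mild_solution (T := T) (n := n) (fun s => h (Rmax 0 s)) u0)).
{ intros h Hh; apply (mild_solution_continuous T_semigroup T_gen A_resolvent X1_dom M_pos
    T_X1 Hg1 C_pos T_Z n_gamma), Hext, Hh. }
assert (Hinit : forall h : R -> Z,
  mild_solution (T := T) (n := n) (fun s => h (Rmax 0 s)) u0 0 = u0).
{ intros h; apply (mild_solution_0 T_semigroup X1_dom). }
split; trivial.
- intros h u Hh Hu Hu0 Du.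
  apply (linear_cauchy_unique T_semigroup T_gen A_resolvent X1_dom M_pos T_X1 _ _
    (fun t => emb (h t))); auto.
  now rewrite Hinit.
- intros q Hq.
  destruct (duhamel_contraction T_semigroup T_gen A_resolvent X1_dom M_pos T_X1
    Hg1 C_pos T_Z n_gamma q Hq) as [lambda0 H].
  exists lambda0; intros lambda Hl h k Hh Hk K t HK Ht Hhk.
  unfold mild_solution.
  refine (Rle_trans _ _ _ (Req_le _ _ (f_equal norm _))
    (H lambda Hl (fun s => h (Rmax 0 s)) (fun s => k (Rmax 0 s)) (Hext h Hh) (Hext k Hk) K t HK Ht _)); [vec|].
  intros s Hs; rewrite Rmax_right by lra; auto.
- exists (Rabs omega), ((M + 1) * norm u0); split.
  { apply Rmult_le_pos; [lra|apply norm_ge_0]. }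
  intros t Ht; unfold mild_solution.
  assert (E : duhamel (T := T) (n := n) (fun _ => zero : Z) t = zero :> X1).
  { unfold duhamel; rewrite (RInt_ext _ (fun _ => zero)), RInt_const.
    - vec.
    - intros tau _.
      assert (Z0 : (zero : Z) = minus zero zero) by vec.
      rewrite Z0 at 1.
      rewrite (kernel_minus T_semigroup X1_dom T_Z); vec. }
  rewrite E.
  apply (Rle_trans _ (norm (T1 T t u0))); [right; f_equal; vec|].
  rewrite (proj2 X1_dom), (op_T1 T_semigroup T_gen X1_dom) by trivial.
  apply (Rle_trans _ _ _ (semigroup_bound T_semigroup T_gen A_resolvent X1_dom M_pos T_X1
    t _ Ht)).
  rewrite <- (proj2 X1_dom); right; ring.
Qed.

(** * Products *)

Lemma norm_fst_le {U V : Normed} (p : prod_NormedModule R_AbsRing U V) :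
  norm (fst p) <= norm p.
Proof.
apply Rsqr_incr_0_var; [|apply norm_ge_0].
change (norm p) with (sqrt (norm (fst p) ^ 2 + norm (snd p) ^ 2)).
rewrite Rsqr_sqrt; unfold Rsqr; nra.
Qed.

Lemma norm_snd_le {U V : Normed} (p : prod_NormedModule R_AbsRing U V) :
  norm (snd p) <= norm p.
Proof.
apply Rsqr_incr_0_var; [|apply norm_ge_0].
change (norm p) with (sqrt (norm (fst p) ^ 2 + norm (snd p) ^ 2)).
rewrite Rsqr_sqrt; unfold Rsqr; nra.
Qed.

Lemma norm_pair_le {U V : Normed} (p : prod_NormedModule R_AbsRing U V) :
  norm p <= norm (fst p) + norm (snd p).
Proof.
assert (H : forall a b, 0 <= a -> 0 <= b -> sqrt (a ^ 2 + b ^ 2) <= a + b).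
{ intros a b Ha Hb; apply Rsqr_incr_0_var; [|lra].
  assert (Hab : 0 <= a * b) by now apply Rmult_le_pos.
  rewrite Rsqr_sqrt; unfold Rsqr; nra. }
apply H; apply norm_ge_0.
Qed.

Lemma continuous_on_halfline_pair {U V : Normed}
    (w : R -> prod_NormedModule R_AbsRing U V) :
  continuous_on_halfline (fun t => fst (w t)) ->
  continuous_on_halfline (fun t => snd (w t)) -> continuous_on_halfline w.
Proof.
rewrite !continuous_on_halfline_iff; intros H1 H2 t Ht eta Heta.
destruct (H1 t Ht (eta / 2) ltac:(lra)) as [r1 [Hr1 K1]].
destruct (H2 t Ht (eta / 2) ltac:(lra)) as [r2 [Hr2 K2]].
exists (Rmin r1 r2); split; [now apply Rmin_pos|]; intros s Hs Hst.
apply Rmin_Rgt_l in Hst; destruct Hst as [S1 S2].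
apply (Rle_lt_trans _ _ _ (norm_pair_le _)).
replace eta with (eta / 2 + eta / 2) by field.
exact (Rplus_lt_compat _ _ _ _ (K1 s Hs S1) (K2 s Hs S2)).
Qed.

Lemma continuous_on_halfline_fst {U V : Normed}
    (w : R -> prod_NormedModule R_AbsRing U V) :
  continuous_on_halfline w -> continuous_on_halfline (fun t => fst (w t)).
Proof.
rewrite !continuous_on_halfline_iff; intros H t Ht eta Heta.
destruct (H t Ht eta Heta) as [r [Hr K]].
exists r; split; trivial; intros s Hs Hst.
apply (Rle_lt_trans _ _ _ (norm_fst_le (minus (w s) (w t)))); auto.
Qed.

Lemma continuous_on_halfline_snd {U V : Normed}
    (w : R -> prod_NormedModule R_AbsRing U V) :
  continuous_on_halfline w -> continuous_on_halfline (fun t => snd (w t)).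
Proof.
rewrite !continuous_on_halfline_iff; intros H t Ht eta Heta.
destruct (H t Ht eta Heta) as [r [Hr K]].
exists r; split; trivial; intros s Hs Hst.
apply (Rle_lt_trans _ _ _ (norm_snd_le (minus (w s) (w t)))); auto.
Qed.

Lemma continuous_on_halfline_lipschitz {U V : Normed} (G : U -> V) L (w : R -> U) :
  (forall p q, norm (minus (G p) (G q)) <= L * norm (minus p q)) ->
  continuous_on_halfline w -> continuous_on_halfline (fun t => G (w t)).
Proof.
rewrite !continuous_on_halfline_iff; intros HG H t Ht eta Heta.
assert (HL : 0 < Rabs L + 1) by (generalize (Rabs_pos L); lra).
destruct (H t Ht (eta / (Rabs L + 1))) as [r [Hr K]]; [now apply Rdiv_lt_0_compat|].
exists r; split; trivial; intros s Hs Hst.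
specialize (K s Hs Hst).
apply (Rle_lt_trans _ _ _ (HG _ _)).
generalize (norm_ge_0 (minus (w s) (w t))) (Rle_abs L); intros N1 N2.
apply (Rle_lt_trans _ ((Rabs L + 1) * norm (minus (w s) (w t)))); [nra|].
replace eta with ((Rabs L + 1) * (eta / (Rabs L + 1))) by (field; lra).
now apply Rmult_lt_compat_l.
Qed.

(** * A fixed point theorem in exponentially weighted spaces *)

Lemma half_pow_small K eta : 0 < eta -> exists n, K * (1 / 2) ^ n < eta.
Proof.
intros Heta.
assert (HK : 0 < Rabs K + 1) by (generalize (Rabs_pos K); lra).
destruct (pow_lt_1_zero (1 / 2)) with (y := eta / (Rabs K + 1)) as [n Hn].
{ rewrite Rabs_pos_eq; lra. }
{ now apply Rdiv_lt_0_compat. }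
exists n; specialize (Hn n (Nat.le_refl n)).
assert (Hp : 0 < (1 / 2) ^ n) by (apply pow_lt; lra).
rewrite Rabs_pos_eq in Hn by lra.
generalize (Rle_abs K); intros Ha.
apply (Rle_lt_trans _ ((Rabs K + 1) * (1 / 2) ^ n)); [nra|].
replace eta with ((Rabs K + 1) * (eta / (Rabs K + 1))) by (field; lra).
now apply Rmult_lt_compat_l.
Qed.

(** Completeness, for sequences whose increments halve. *)
Lemma geometric_limit {V : Banach} (x : nat -> V) K :
  (forall n, norm (minus (x (S n)) (x n)) <= K * (1 / 2) ^ n) ->
  exists l, forall n, norm (minus (x n) l) <= 2 * K * (1 / 2) ^ n.
Proof.
intros H.
assert (HK : 0 <= K).
{ generalize (norm_ge_0 (minus (x 1%nat) (x O))) (H O); simpl; lra. }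
assert (Hm : forall n k, norm (minus (x (n + k)%nat) (x n)) <=
  2 * K * ((1 / 2) ^ n - (1 / 2) ^ (n + k))).
{ intros n k; induction k as [|k IH].
  - rewrite Nat.add_0_r; canon; rewrite norm_minus_self; lra.
  - rewrite Nat.add_succ_r.
    apply (Rle_trans _ _ _ (norm_minus_triangle (x (n + k)%nat) _ _)).
    specialize (H (n + k)%nat).
    change ((1 / 2) ^ S (n + k)) with (1 / 2 * (1 / 2) ^ (n + k)).
    canon; lra. }
assert (Hc : forall n m, (n <= m)%nat ->
  norm (minus (x m) (x n)) <= 2 * K * (1 / 2) ^ n).
{ intros n m Hnm; replace m with (n + (m - n))%nat by lia.
  assert (0 <= (1 / 2) ^ (n + (m - n))) by (apply pow_le; lra).
  specialize (Hm n (m - n)%nat); nra. }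
destruct (proj1 (filterlim_locally_cauchy (F := eventually) x)) as [l Hl].
{ intros eps; destruct (half_pow_small (4 * K) eps (cond_pos eps)) as [n Hn].
  exists (fun m => (n <= m)%nat); split; [now exists n|].
  intros u v Hu Hv.
  apply (norm_compat1 (V := V)).
  apply (Rle_lt_trans _ _ _ (norm_minus_triangle (x n) _ _)).
  canon; rewrite (norm_minus_sym (x n)).
  generalize (Hc n u Hu) (Hc n v Hv); canon; lra. }
exists l; intros n.
apply (le_all_eps _ _ 1); [lra|]; intros eta Heta.
destruct (proj1 (filterlim_norm_iff x l) Hl eta Heta) as [m Hm'].
specialize (Hm' (max n m) (Nat.le_max_r n m)).
apply (Rle_trans _ _ _ (norm_minus_triangle (x (max n m)) _ _)).
canon; rewrite (norm_minus_sym (x n)).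
generalize (Hc n (max n m) (Nat.le_max_l n m)); cbv beta in *; canon; lra.
Qed.

Section Fixed_point.
Context {U V : Banach} {W : Normed}.
Let E := prod_NormedModule R_AbsRing U V.
Context (G : E -> W) (P : (R -> W) -> R -> E) (L q lambda K0 : R)
  (L_nonneg : 0 <= L)
  (G_lipschitz : forall x y, norm (minus (G x) (G y)) <= L * norm (minus x y))
  (P_continuous : forall h, continuous_on_halfline h -> continuous_on_halfline (P h))
  (lambda_nonneg : 0 <= lambda) (qL : q * L <= 1 / 2)
  (P_contraction : forall h k, continuous_on_halfline h -> continuous_on_halfline k ->
    forall K t, 0 <= K -> 0 <= t ->
    (forall s, 0 <= s <= t -> norm (minus (h s) (k s)) <= K * exp (lambda * s)) ->
    norm (minus (P h t) (P k t)) <= q * K * exp (lambda * t))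
  (P_bound : forall t, 0 <= t -> norm (P (fun _ => G zero) t) <= K0 * exp (lambda * t)).

Lemma composition_continuous w :
  continuous_on_halfline w -> continuous_on_halfline (fun t => G (w t)).
Proof. now apply continuous_on_halfline_lipschitz with L. Qed.

Lemma composition_contraction (w z : R -> E) K t :
  continuous_on_halfline w -> continuous_on_halfline z -> 0 <= K -> 0 <= t ->
  (forall s, 0 <= s <= t -> norm (minus (w s) (z s)) <= K * exp (lambda * s)) ->
  norm (minus (P (fun s => G (w s)) t) (P (fun s => G (z s)) t)) <=
    K * (1 / 2) * exp (lambda * t).
Proof.
intros Hw Hz HK Ht H.
apply (Rle_trans _ (q * (L * K) * exp (lambda * t))).
- apply P_contraction; trivial; try now apply composition_continuous.
  + now apply Rmult_le_pos.
  + intros s Hs; apply (Rle_trans _ _ _ (G_lipschitz _ _)).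
    rewrite Rmult_assoc; apply Rmult_le_compat_l; auto.
- apply Rmult_le_compat_r; [left; apply exp_pos|]; nra.
Qed.

Fixpoint picard (n : nat) : R -> E :=
  match n with
  | O => fun _ => zero
  | S n => P (fun s => G (picard n s))
  end.

Lemma picard_continuous n : continuous_on_halfline (picard n).
Proof.
induction n as [|n IH]; simpl.
- intros t _; apply filterlim_const.
- now apply P_continuous, composition_continuous.
Qed.

Lemma K0_nonneg : 0 <= K0.
Proof.
generalize (P_bound 0 (Rle_refl 0)) (norm_ge_0 (P (fun _ => G zero) 0)).
rewrite Rmult_0_r, exp_0; lra.
Qed.

(** The first iterate obeys the exponential bound [P_bound]; each further step gains the
    factor [1 / 2]. *)
Lemma picard_step n t : 0 <= t ->
  norm (minus (picard (S n) t) (picard n t)) <= K0 * (1 / 2) ^ n * exp (lambda * t).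
Proof.
assert (HK := K0_nonneg).
revert t; induction n as [|n IH]; intros t Ht.
- rewrite pow_O, Rmult_1_r; simpl.
  apply (Rle_trans _ (norm (P (fun _ => G zero) t))); [right; f_equal; vec|auto].
- change ((1 / 2) ^ S n) with (1 / 2 * (1 / 2) ^ n).
  replace (K0 * (1 / 2 * (1 / 2) ^ n)) with (K0 * (1 / 2) ^ n * (1 / 2)) by ring.
  apply (composition_contraction (picard (S n)) (picard n)); trivial;
    try apply picard_continuous.
  + apply Rmult_le_pos; trivial; apply pow_le; lra.
  + intros s Hs; apply IH; lra.
Qed.

Lemma picard_limit t : 0 <= t -> exists p : E, forall n,
  norm (minus (picard n t) p) <= 4 * (K0 * exp (lambda * t)) * (1 / 2) ^ n.
Proof.
intros Ht.
assert (Hs : forall n, norm (minus (picard (S n) t) (picard n t)) <=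
  K0 * exp (lambda * t) * (1 / 2) ^ n).
{ intros n; generalize (picard_step n t Ht).
  now replace (K0 * exp (lambda * t) * (1 / 2) ^ n) with
    (K0 * (1 / 2) ^ n * exp (lambda * t)) by ring. }
destruct (geometric_limit (fun n => fst (picard n t)) (K0 * exp (lambda * t))) as [l1 H1].
{ intros n; apply (Rle_trans _ _ _ (norm_fst_le (minus (picard (S n) t) (picard n t)))), Hs. }
destruct (geometric_limit (fun n => snd (picard n t)) (K0 * exp (lambda * t))) as [l2 H2].
{ intros n; apply (Rle_trans _ _ _ (norm_snd_le (minus (picard (S n) t) (picard n t)))), Hs. }
exists (l1, l2); intros n.
apply (Rle_trans _ _ _ (norm_pair_le _)).
apply (Rle_trans _ _ _ (Rplus_le_compat _ _ _ _ (H1 n) (H2 n))); lra.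
Qed.

(** The Picard iterates converge uniformly on bounded intervals.  For uniqueness, two
    fixed points are a priori only bounded on each interval [[0, t]]; the contraction
    property on this interval makes their distance as small as wanted. *)
Theorem fixed_point_exists_unique : exists u : R -> E,
  continuous_on_halfline u /\
  (forall t, 0 <= t -> u t = P (fun s => G (u s)) t) /\
  forall v : R -> E, continuous_on_halfline v ->
    (forall t, 0 <= t -> v t = P (fun s => G (v s)) t) ->
    forall t, 0 <= t -> v t = u t.
Proof.
assert (HK := K0_nonneg).
set (u := fun t => epsilon (inhabits (zero : E)) (fun p => forall n,
  norm (minus (picard n t) p) <= 4 * (K0 * exp (lambda * t)) * (1 / 2) ^ n)).
assert (Hu : forall t, 0 <= t -> forall n,
  norm (minus (picard n t) (u t)) <= 4 * (K0 * exp (lambda * t)) * (1 / 2) ^ n).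
{ intros t Ht; exact (epsilon_spec _ _ (picard_limit t Ht)). }
assert (Cu : continuous_on_halfline u).
{ apply continuous_on_halfline_iff; intros t Ht eta Heta.
  destruct (half_pow_small (4 * (K0 * exp (lambda * (t + 1)))) (eta / 3) ltac:(lra))
    as [n Hn].
  assert (Hle : forall s, 0 <= s <= t + 1 -> norm (minus (picard n s) (u s)) < eta / 3).
  { intros s Hs; apply (Rle_lt_trans _ _ _ (Hu s (proj1 Hs) n)).
    refine (Rle_lt_trans _ _ _ _ Hn).
    apply Rmult_le_compat_r; [apply pow_le; lra|].
    apply Rmult_le_compat_l; [lra|]; apply Rmult_le_compat_l; trivial.
    apply exp_le; nra. }
  destruct (proj1 (continuous_on_halfline_iff _) (picard_continuous n) t Ht (eta / 3)
    ltac:(lra)) as [r [Hr H]].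
  exists (Rmin 1 r); split; [apply Rmin_pos; lra|]; intros s Hs Hst.
  apply Rmin_Rgt_l in Hst; destruct Hst as [S1 S2].
  apply (Rle_lt_trans _ _ _ (norm_minus_triangle (picard n s) _ _)).
  generalize (norm_minus_triangle (picard n t) (picard n s) (u t)).
  rewrite (norm_minus_sym (u s)).
  generalize (H s Hs S2) (Hle t ltac:(lra)).
  apply Rabs_def2 in S1; generalize (Hle s ltac:(lra)).
  lra. }
assert (Hfix : forall t, 0 <= t -> u t = P (fun s => G (u s)) t).
{ intros t Ht.
  assert (Hz : norm (minus (u t) (P (fun s => G (u s)) t)) = 0).
  { apply Rle_antisym; [|apply norm_ge_0].
    apply (le_all_eps _ _ 1); [lra|]; intros eta Heta.
    destruct (half_pow_small (4 * (K0 * exp (lambda * t))) eta Heta) as [n Hn].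
    apply (Rle_trans _ _ _ (norm_minus_triangle (picard (S n) t) _ _)).
    rewrite (norm_minus_sym (u t)).
    generalize (Hu t Ht (S n)).
    assert (Hp : 0 <= (1 / 2) ^ n) by (apply pow_le; lra).
    generalize (composition_contraction (picard n) u (4 * K0 * (1 / 2) ^ n) t
      (picard_continuous n) Cu ltac:(nra) Ht).
    change ((1 / 2) ^ S n) with (1 / 2 * (1 / 2) ^ n).
    intros H1 H2; specialize (H1 ltac:(intros s Hs; generalize (Hu s (proj1 Hs) n); lra)).
    change (picard (S n) t) with (P (fun s => G (picard n s)) t) in *; lra. }
  apply norm_eq_zero in Hz.
  replace (u t) with (plus (minus (u t) (P (fun s => G (u s)) t)) (P (fun s => G (u s)) t))
    by vec.
  rewrite Hz; vec. }
exists u; split; [trivial|]; split; trivial.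
- intros v Cv Hv t Ht.
  destruct (bounded_continuity (fun s => v (Rmax 0 s)) 0 t) as [M1 H1].
  { intros s _; exact (continuous_halfline_extension v s Cv). }
  destruct (bounded_continuity (fun s => u (Rmax 0 s)) 0 t) as [M2 H2].
  { intros s _; exact (continuous_halfline_extension u s Cu). }
  assert (Hd : forall s, 0 <= s <= t -> norm (minus (v s) (u s)) <= M1 + M2).
  { intros s Hs; apply (Rle_trans _ _ _ (norm_minus_le _ _)).
    specialize (H1 s Hs); specialize (H2 s Hs); rewrite Rmax_right in H1, H2 by lra; lra. }
  assert (HM : 0 <= M1 + M2)
    by (generalize (norm_ge_0 (minus (v 0) (u 0))) (Hd 0 ltac:(lra)); lra).
  assert (Hn : forall n s, 0 <= s <= t ->
    norm (minus (v s) (u s)) <= (M1 + M2) * (1 / 2) ^ n * exp (lambda * s)).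
  { induction n as [|n IH]; intros s Hs.
    - rewrite pow_O, Rmult_1_r; apply (Rle_trans _ _ _ (Hd s Hs)).
      rewrite <- (Rmult_1_r (M1 + M2)) at 1; apply Rmult_le_compat_l; trivial.
      rewrite <- exp_0 at 1; apply exp_le; nra.
    - rewrite Hv, Hfix by lra.
      change ((1 / 2) ^ S n) with (1 / 2 * (1 / 2) ^ n).
      replace ((M1 + M2) * (1 / 2 * (1 / 2) ^ n)) with
        ((M1 + M2) * (1 / 2) ^ n * (1 / 2)) by ring.
      apply composition_contraction; trivial; [|lra|].
      + apply Rmult_le_pos; trivial; apply pow_le; lra.
      + intros s' Hs'; apply IH; lra. }
  assert (Hz : norm (minus (v t) (u t)) = 0).
  { apply Rle_antisym; [|apply norm_ge_0].
    apply (le_all_eps _ _ 1); [lra|]; intros eta Heta.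
    destruct (half_pow_small ((M1 + M2) * exp (lambda * t)) eta Heta) as [n Hsmall].
    specialize (Hn n t ltac:(lra)); lra. }
  apply norm_eq_zero in Hz.
  replace (v t) with (plus (minus (v t) (u t)) (u t)) by vec.
  rewrite Hz; vec.
Qed.
End Fixed_point.

(** * Semilinear systems *)

Definition solves_system {X Y : Normed} (A : operator X) (B : operator Y)
    {X1 ZA : banach_in X} {Y1 ZB : banach_in Y}
    (F : prod_NormedModule R_AbsRing X1 Y1 -> ZA)
    (G : prod_NormedModule R_AbsRing X1 Y1 -> ZB)
    (u0 : X1) (v0 : Y1) (u : R -> X1) (v : R -> Y1) : Prop :=
  continuous_on_halfline u /\ continuous_on_halfline v /\
  has_derivative_on_halfline (fun t => emb (u t))
    (fun t => plus (op A (emb (u t))) (emb (F (u t, v t)))) /\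
  has_derivative_on_halfline (fun t => emb (v t))
    (fun t => plus (op B (emb (v t))) (emb (G (u t, v t)))) /\
  u 0 = u0 /\ v 0 = v0.

Lemma norm_pair_bound {U V : Normed} (p : prod_NormedModule R_AbsRing U V) a b :
  norm (fst p) <= a -> norm (snd p) <= b -> norm p <= a + b.
Proof.
intros Ha Hb; apply (Rle_trans _ _ _ (norm_pair_le p)).
now apply Rplus_le_compat.
Qed.

(** The solution operators turn the system into a fixed point problem for
    [(u, v)]; a common weight [lambda] serves both components. *)
Lemma semilinear_system {X Y : Normed} (A : operator X) (B : operator Y)
    (X1 ZA : banach_in X) (Y1 ZB : banach_in Y)
    (F : prod_NormedModule R_AbsRing X1 Y1 -> ZA)
    (G : prod_NormedModule R_AbsRing X1 Y1 -> ZB)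
    (u0 : X1) (v0 : Y1) SA SB LF LG :
  solution_operator A X1 ZA u0 SA -> solution_operator B Y1 ZB v0 SB ->
  0 <= LF -> 0 <= LG ->
  (forall p q, norm (minus (F p) (F q)) <= LF * norm (minus p q)) ->
  (forall p q, norm (minus (G p) (G q)) <= LG * norm (minus p q)) ->
  exists u v, solves_system A B F G u0 v0 u v /\
    forall u' v', solves_system A B F G u0 v0 u' v' ->
      forall t, 0 <= t -> u' t = u t /\ v' t = v t.
Proof.
intros HA HB HLF HLG LipF LipG.
set (W := prod_NormedModule R_AbsRing ZA ZB).
set (E := prod_NormedModule R_AbsRing X1 Y1).
set (N := fun p : E => (F p, G p) : W).
set (P := fun (h : R -> W) (t : R) =>
  (SA (fun s => fst (h s)) t, SB (fun s => snd (h s)) t) : E).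
set (L := LF + LG).
assert (HL : 0 <= L) by (unfold L; lra).
assert (LipN : forall p q, norm (minus (N p) (N q)) <= L * norm (minus p q)).
{ intros p q; unfold L; rewrite Rmult_plus_distr_r.
  apply norm_pair_bound; [apply LipF|apply LipG]. }
assert (Pcont : forall h, continuous_on_halfline h -> continuous_on_halfline (P h)).
{ intros h Hh; apply continuous_on_halfline_pair.
  - apply (solution_continuous HA), continuous_on_halfline_fst, Hh.
  - apply (solution_continuous HB), continuous_on_halfline_snd, Hh. }
set (q := / (4 * (L + 1))).
assert (Hq : 0 < q) by (apply Rinv_0_lt_compat; lra).
destruct (solution_contraction HA q Hq) as [lA HlA].
destruct (solution_contraction HB q Hq) as [lB HlB].
destruct (solution_homogeneous_bound HA) as [mA [KA [HKA HmA]]].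
destruct (solution_homogeneous_bound HB) as [mB [KB [HKB HmB]]].
set (lambda := Rmax 0 (Rmax (Rmax lA lB) (Rmax mA mB))).
assert (Hl : 0 <= lambda /\ lA <= lambda /\ lB <= lambda /\ mA <= lambda /\ mB <= lambda).
{ generalize (Rmax_l 0 (Rmax (Rmax lA lB) (Rmax mA mB)))
    (Rmax_r 0 (Rmax (Rmax lA lB) (Rmax mA mB)))
    (Rmax_l (Rmax lA lB) (Rmax mA mB)) (Rmax_r (Rmax lA lB) (Rmax mA mB))
    (Rmax_l lA lB) (Rmax_r lA lB) (Rmax_l mA mB) (Rmax_r mA mB).
  fold lambda; lra. }
destruct Hl as [Hl0 [HlA' [HlB' [HmA' HmB']]]].
assert (Pcontr : forall h k, continuous_on_halfline h -> continuous_on_halfline k ->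
  forall K t, 0 <= K -> 0 <= t ->
  (forall s, 0 <= s <= t -> norm (minus (h s) (k s)) <= K * exp (lambda * s)) ->
  norm (minus (P h t) (P k t)) <= 2 * q * K * exp (lambda * t)).
{ intros h k Hh Hk K t HK Ht Hhk.
  replace (2 * q * K * exp (lambda * t)) with
    (q * K * exp (lambda * t) + q * K * exp (lambda * t)) by ring.
  apply norm_pair_bound.
  - apply (HlA lambda HlA'); trivial; try now apply continuous_on_halfline_fst.
    intros s Hs; apply (Rle_trans _ _ _ (norm_fst_le (minus (h s) (k s)))); auto.
  - apply (HlB lambda HlB'); trivial; try now apply continuous_on_halfline_snd.
    intros s Hs; apply (Rle_trans _ _ _ (norm_snd_le (minus (h s) (k s)))); auto. }
set (K0 := 2 * q * norm (N zero) + (KA + KB)).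
assert (Pbound : forall t, 0 <= t ->
  norm (P (fun _ => N zero) t) <= K0 * exp (lambda * t)).
{ intros t Ht.
  apply (Rle_trans _ _ _ (norm_le_minus _ (P (fun _ => zero) t))).
  unfold K0; rewrite Rmult_plus_distr_r; apply Rplus_le_compat.
  - apply Pcontr; trivial; try (intros s _; apply filterlim_const); [apply norm_ge_0|].
    intros s Hs; apply (Rle_trans _ (norm (N zero))); [right; f_equal; vec|].
    rewrite <- (Rmult_1_r (norm (N zero))) at 1.
    apply Rmult_le_compat_l; [apply norm_ge_0|].
    rewrite <- exp_0 at 1; apply exp_le; nra.
  - rewrite Rmult_plus_distr_r; apply norm_pair_bound.
    + apply (Rle_trans _ _ _ (HmA t Ht)), Rmult_le_compat_l; trivial.
      apply exp_le; nra.
    + apply (Rle_trans _ _ _ (HmB t Ht)), Rmult_le_compat_l; trivial.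
      apply exp_le; nra. }
assert (HqL : 2 * q * L <= 1 / 2).
{ assert (q * (4 * (L + 1)) = 1) by (unfold q; field; lra); nra. }
destruct (fixed_point_exists_unique N P L (2 * q) lambda K0 HL LipN Pcont Hl0 HqL
  Pcontr Pbound) as [z [Cz [Hz Uz]]].
assert (Csys : forall u v, continuous_on_halfline u -> continuous_on_halfline v ->
  continuous_on_halfline (fun t => F (u t, v t)) /\
  continuous_on_halfline (fun t => G (u t, v t))).
{ intros u v Hu Hv.
  assert (Huv : continuous_on_halfline (fun t => (u t, v t) : E))
    by now apply continuous_on_halfline_pair.
  split; [apply (continuous_on_halfline_lipschitz F LF (fun t => (u t, v t) : E))|
    apply (continuous_on_halfline_lipschitz G LG (fun t => (u t, v t) : E))]; trivial. }
set (u := SA (fun s => F (z s))).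
set (v := SB (fun s => G (z s))).
assert (Fz : continuous_on_halfline (fun s => F (z s)))
  by now apply (continuous_on_halfline_lipschitz F LF).
assert (Gz : continuous_on_halfline (fun s => G (z s)))
  by now apply (continuous_on_halfline_lipschitz G LG).
assert (Huv : forall t, 0 <= t -> z t = (u t, v t)) by exact Hz.
exists u, v; split.
- refine (conj _ (conj _ (conj _ (conj _ (conj _ _))))).
  + now apply (solution_continuous HA).
  + now apply (solution_continuous HB).
  + intros t Ht; rewrite <- (Huv t Ht); now apply (solution_derivative HA).
  + intros t Ht; rewrite <- (Huv t Ht); now apply (solution_derivative HB).
  + now apply (solution_initial HA).
  + now apply (solution_initial HB).
- intros u' v' [Cu [Cv [Du [Dv [Iu Iv]]]]] t Ht.
  destruct (Csys u' v' Cu Cv) as [Fu Gu].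
  assert (H : (u' t, v' t) = z t).
  { apply (Uz (fun t => (u' t, v' t))); trivial; [now apply continuous_on_halfline_pair|].
    intros s Hs; unfold P, N; simpl; f_equal.
    - now apply (solution_unique HA).
    - now apply (solution_unique HB). }
  rewrite Huv in H by trivial; now injection H.
Qed.

Theorem proposition2p5
  (X Y : CompleteNormedModule R_AbsRing)
  (A : operator X) (B : operator Y)
  (eA : R -> X -> X) (eB : R -> Y -> Y)
  (A_closed : closed_operator A) (A_dense : densely_defined A)
  (B_closed : closed_operator B) (B_dense : densely_defined B)
  (eA_semigroup : C0_semigroup eA) (eA_gen : generates A eA)
  (eB_semigroup : C0_semigroup eB) (eB_gen : generates B eB)
  (A_resolvent : zero_in_resolvent_set A)
  (B_resolvent : zero_in_resolvent_set B)
  (X1 : banach_in X) (X1_dom : domain_space A X1)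
  (Y1 : banach_in Y) (Y1_dom : domain_space B Y1)
  (IX IY : R -> interpolation_method)
  (IX_adm : forall theta, 0 < theta < 1 -> exact_admissible (IX theta))
  (IY_adm : forall theta, 0 < theta < 1 -> exact_admissible (IY theta))
  (gamma delta : R)
  (gamma_range : 0 < gamma <= 1)
  (gamma_1 : ~ analytic_semigroup eA -> gamma = 1)
  (delta_range : 0 < delta <= 1)
  (delta_1 : ~ analytic_semigroup eB -> delta = 1)
  (CA CB MA MB omegaA omegaB : R)
  (CA_pos : 0 < CA) (CB_pos : 0 < CB) (MA_pos : 0 < MA) (MB_pos : 0 < MB)
  (eA_X1 : forall t, 0 < t -> maps X1 X1 (eA t) (MA * exp (omegaA * t)))
  (eA_Xgamma : forall t, 0 < t ->
     maps (scale IX X1 gamma) X1 (eA t)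
       (CA * Rpower t (gamma - 1) * exp (omegaA * t)))
  (eB_Y1 : forall t, 0 < t -> maps Y1 Y1 (eB t) (MB * exp (omegaB * t)))
  (eB_Ydelta : forall t, 0 < t ->
     maps (scale IY Y1 delta) Y1 (eB t)
       (CB * Rpower t (delta - 1) * exp (omegaB * t)))
  (alpha : R) (alpha_range : 0 <= alpha < 1)
  (gamma_alpha : 0 <= gamma - (1 - alpha) <= 1)
  (f : prod_NormedModule R_AbsRing (scale IX X1 alpha) Y1 ->
       scale IX X1 (gamma - (1 - alpha)))
  (g : prod_NormedModule R_AbsRing X1 Y1 -> scale IY Y1 delta)
  (f_C2 : twice_continuously_differentiable f)
  (f_Xgamma : forall (x : X1) (y : Y1),
     exists z : scale IX X1 gamma, emb z = emb (f (incl x, y)))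
  (Lf Lg : R) (Lf_pos : 0 < Lf) (Lg_pos : 0 < Lg)
  (Df_X1 : forall p : prod_NormedModule R_AbsRing X1 Y1,
     exists D : prod_NormedModule R_AbsRing X1 Y1 -> scale IX X1 gamma,
       filterdiff
         (fun q : prod_NormedModule R_AbsRing X1 Y1 =>
            incl (f (incl (fst q), snd q)) : scale IX X1 gamma)
         (locally p) D /\
       opnorm_le D Lf)
  (Dg_X1 : forall p : prod_NormedModule R_AbsRing X1 Y1,
     exists D : prod_NormedModule R_AbsRing X1 Y1 -> scale IY Y1 delta,
       filterdiff g (locally p) D /\ opnorm_le D Lg)
  (Df_Xalpha : forall (p : prod_NormedModule R_AbsRing (scale IX X1 alpha) Y1)
       (D : prod_NormedModule R_AbsRing (scale IX X1 alpha) Y1 ->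
            scale IX X1 (gamma - (1 - alpha))),
     filterdiff f (locally p) D ->
     exists D' : prod_NormedModule R_AbsRing
                   (scale IX X1 alpha) (scale IY Y1 alpha) ->
                 scale IX X1 (gamma - (1 - alpha)),
       is_linear D' /\ opnorm_le D' Lf /\
       forall (h : scale IX X1 alpha) (k : Y1), D (h, k) = D' (h, incl k))
  (f_00 : f (zero, zero) = zero)
  (g_00 : g (zero, zero) = zero) :
  exists eps0 : R, 0 < eps0 /\
    forall eps : R, 0 < eps < eps0 ->
    forall (u0 : X1) (v0 : Y1), f (incl u0, v0) = zero ->
    exists (u : R -> X1) (v : R -> Y1),
      strict_solution A B f g eps u0 v0 u v /\
      forall (u' : R -> X1) (v' : R -> Y1),
        strict_solution A B f g eps u0 v0 u' v' ->
        forall t, 0 <= t -> u' t = u t /\ v' t = v t.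
Proof.
(* The exponential weight absorbs the factor [1 / eps], however large it is. *)
exists 1; split; [lra|]; intros eps Heps u0 v0 _.
destruct (linear_cauchy_problem A eA X1 (scale IX X1 gamma) MA omegaA gamma CA u0)
  as [SA HSA]; trivial.
destruct (linear_cauchy_problem B eB Y1 (scale IY Y1 delta) MB omegaB delta CB v0)
  as [SB HSB]; trivial.
set (E := prod_NormedModule R_AbsRing X1 Y1).
set (F0 := fun q : E => incl (f (incl (fst q), snd q)) : scale IX X1 gamma).
assert (HF0 : forall q : E, emb (F0 q) = emb (f (incl (fst q), snd q))).
{ intros q; exact (epsilon_spec (inhabits zero) _ (f_Xgamma (fst q) (snd q))). }
set (F := fun q : E => scal (1 / eps) (F0 q)).
assert (He : 0 < 1 / eps) by (apply Rdiv_lt_0_compat; lra).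
assert (LipF : forall p q, norm (minus (F p) (F q)) <= 1 / eps * Lf * norm (minus p q)).
{ intros p q; unfold F.
  apply (Rle_trans _ (norm (scal (1 / eps) (minus (F0 p) (F0 q)))));
    [right; f_equal; vec|].
  refine (Rle_trans _ _ _ (Req_le _ _ (norm_scal_R _ _)) _).
  rewrite Rabs_pos_eq, Rmult_assoc by lra; apply Rmult_le_compat_l; [lra|].
  apply (lipschitz_of_derivative F0 Lf); [lra|exact Df_X1]. }
assert (Lipg : forall p q, norm (minus (g p) (g q)) <= Lg * norm (minus p q)).
{ intros p q; apply (lipschitz_of_derivative g Lg); [lra|exact Dg_X1]. }
destruct (semilinear_system A B X1 (scale IX X1 gamma) Y1 (scale IY Y1 delta) F g u0 v0
  SA SB (1 / eps * Lf) Lg HSA HSB) as [u [v [Huv Uuv]]]; trivial.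
{ apply Rmult_le_pos; lra. }
{ lra. }
assert (Heq : forall p, emb (F p) = scal (1 / eps) (emb (f (incl (fst p), snd p)))).
{ intros p; unfold F; rewrite <- HF0; apply (linear_scal emb (emb_linear _)). }
exists u, v; split.
- destruct Huv as [Cu [Cv [Du [Dv [Iu Iv]]]]].
  assert (Cuv : continuous_on_halfline (fun t => (u t, v t) : E))
    by now apply continuous_on_halfline_pair.
  refine (conj Cu (conj Cv (conj _ (conj _ (conj _ (conj Dv (conj Iu Iv))))))).
  + eexists; split; [exact Du|].
    apply continuous_on_halfline_plus; [now apply (op_continuous X1_dom)|].
    apply continuous_on_halfline_linear; [apply emb_linear|].
    now apply (continuous_on_halfline_lipschitz F (1 / eps * Lf) (fun t => (u t, v t) : E)).
  + eexists; split; [exact Dv|].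
    apply continuous_on_halfline_plus; [now apply (op_continuous Y1_dom)|].
    apply continuous_on_halfline_linear; [apply emb_linear|].
    now apply (continuous_on_halfline_lipschitz g Lg (fun t => (u t, v t) : E)).
  + intros t Ht; generalize (Heq (u t, v t)) (Du t Ht); cbv beta; simpl.
    now intros ->.
- intros u' v' [Cu [Cv [_ [_ [Du [Dv [Iu Iv]]]]]]].
  apply Uuv; refine (conj Cu (conj Cv (conj _ (conj Dv (conj Iu Iv))))).
  intros t Ht; generalize (Heq (u' t, v' t)) (Du t Ht); cbv beta; simpl.
  now intros ->.
Qed.
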